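(* For every integer $n \ge 19$ there exists a $4$-regular graph on $n$ vertices containing exactly $144$ hamiltonian cycles. Furthermore, for every integer $n' \ge 22$ there exists a planar $4$-regular graph on $n'$ vertices containing exactly $320$ hamiltonian cycles.
   Context: Graphs are finite, simple and connected. A hamiltonian cycle is a cycle through all vertices of the graph. *)

(* Defs.v *)
From mathcomp Require Import all_boot all_order all_algebra.
From mathcomp Require Import all_classical all_reals all_analysis.
Set Implicit Arguments.
Unset Strict Implicit.
Unset Printing Implicit Defensive.
Import numFieldNormedType.Exports.
Local Open Scope ring_scope.

Record graph := Graph {
  vertex :> finType;
  adj : rel vertex;
  adj_sym : symmetric adj;
  adj_irrefl : irreflexive adj }.

Definition connected_graph (G : graph) : Prop :=
  forall x y : G, connect (@adj G) x y.

Definition regular_graph (d : nat) (G : graph) : Prop :=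
  forall x : G, #|[set y : G | adj x y]%SET| = d.

Definition edges (G : graph) : {set {set G}} :=
  [set E : {set G} |
     [exists x : G, exists y : G, adj x y && (E == [set x; y])]]%SET.

Definition cycle_edges (G : graph) (s : seq G) : {set {set G}} :=
  [set [set x; next s x] | x in s]%SET.

(* A cycle is a subgraph, here identified with its edge set, so that the
   starting vertex and the direction of traversal are not counted. A
   duplicate-free sequence of length #|G| visits every vertex; the bound
   2 < #|G| excludes the closed walk of length 2 along a single edge. *)
Definition hamiltonian_cycles (G : graph) : {set {set {set G}}} :=
  [set C : {set {set G}} |
     (2 < #|G|)%N &&
     [exists s : #|G|.-tuple G,
        ucycleb (@adj G) s && (C == cycle_edges s)]]%SET.

Definition is_arc (R : realType) (p q : R * R) (A : set (R * R)) : Prop :=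
  exists f : R -> R * R,
    [/\ ({within `[0, 1], continuous f})%classic,
        {in `[0, 1] &, injective f},
        f 0 = p, f 1 = q & A = (f @` `[0, 1])%classic].

(* [curve E] is only meaningful when E is an edge of G. *)
Definition plane_drawing (R : realType) (G : graph)
    (pos : G -> R * R) (curve : {set G} -> set (R * R)) : Prop :=
  [/\ injective pos,
      forall x y : G, adj x y ->
        is_arc (pos x) (pos y) (curve [set x; y]%SET),
      forall (E : {set G}) (z : G),
        E \in edges G -> curve E (pos z) -> z \in E
    & forall (E F : {set G}) (p : R * R),
        E \in edges G -> F \in edges G -> E != F ->
        curve E p -> curve F p ->
        exists2 z : G, z \in (E :&: F)%SET & p = pos z].

Definition planar (R : realType) (G : graph) : Prop :=
  exists (pos : G -> R * R) (curve : {set G} -> set (R * R)),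
    plane_drawing pos curve.

(* Main.v *)
(** The graph with parameters k, N and n >= N has two blocks on k vertices, each
    obtained from a 4-regular graph (K5, resp. the octahedron) by deleting an
    edge, a vertex p, and a right part.  Each block is joined to the rest by
    exactly two edges, one of them ending in p; a hamiltonian cycle uses all of
    these, hence it consists of one hamiltonian path in each block, p, and one
    hamiltonian path of the right part between two fixed vertices u and v.  The
    right part can be extended by a new vertex w adjacent to u and v, which then
    plays the role of u while u plays the role of v: a hamiltonian path from w to
    u has to start with the edge wv, so the number of such paths is unchanged.
    This gives 6 * 6 * 4 = 144 and 8 * 8 * 5 = 320 cycles for all n.

    For planarity the right part is drawn with straight edges in a fixed triangle
    with u and v as corners; an affine map squeezes the drawing to make room for
    the next vertex, and the rest of the drawing does not change. *)
Require Import Defs.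
From mathcomp Require Import all_boot all_order all_algebra.
From mathcomp Require Import all_classical all_reals all_analysis.
From mathcomp Require Import zify ring lra.
Set Implicit Arguments.
Unset Strict Implicit.
Unset Printing Implicit Defensive.

(** * Hamiltonian paths *)

Section HamiltonianPaths.
Variable T : eqType.
Implicit Types (E : rel T) (V s t : seq T) (x y : T).

(** The default values of [head] and [last] are crossed: for [x != y] they make the empty sequence
    fail both end conditions. *)
Definition ham_path E V x y s :=
  [&& perm_eq s V, sorted E s, head y s == x & last x s == y].

(** An enumeration that can be run by computation. [V] holds the vertices still to be visited,
    without the current vertex [x], and [n] is fuel, meant to be the size of [V]. *)
Fixpoint spanning_walks E n V x : seq (seq T) :=
  if n is m.+1 then
    [seq x :: s | s <- flatten [seq spanning_walks E m (rem y V) y | y <- V & E x y]]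
  else [:: [:: x]].

Lemma mem_spanning_walks E n V x s : uniq V -> size V = n ->
  (s \in spanning_walks E n V x) =
  if s is z :: t then [&& z == x, perm_eq t V & path E x t] else false.
Proof.
elim: n V x s => [|n IHn] V x s uV sV /=.
  case: V uV sV => // _ _; rewrite inE.
  case: s => [|z [|w t]] //=; rewrite eqseq_cons andbF.
  by case: permP => [/(_ predT)|]; rewrite // andbF.
case: s => [|z t]; first by apply/negbTE/mapP => -[].
apply/mapP/and3P => [[s /flattenP[_ /mapP[y + ->]]]|[/eqP-> tV Et]].
  rewrite mem_filter => /andP[Exy yV] + [-> ->].
  rewrite IHn ?rem_uniq ?size_rem ?sV //; case: s => // w s /and3P[/eqP-> sV' Es].
  split; rewrite ?eqxx //= ?Exy //.
  by rewrite perm_sym (perm_trans (perm_to_rem yV)) // perm_cons perm_sym.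
exists t => //; case: t tV Et => [/perm_size|y t tV /= /andP[Exy Et]].
  by rewrite sV.
have yV : y \in V by rewrite -(perm_mem tV) mem_head.
apply/flattenP; exists (spanning_walks E n (rem y V) y).
  by apply/mapP; exists y; rewrite // mem_filter Exy.
rewrite IHn ?rem_uniq ?size_rem ?sV // eqxx Et andbT /=.
by have := perm_trans tV (perm_to_rem yV); rewrite perm_cons.
Qed.

Lemma uniq_spanning_walks E n V x : uniq V -> size V = n ->
  uniq (spanning_walks E n V x).
Proof.
elim: n V x => [|n IHn] V x uV sV //=.
rewrite map_inj_uniq; last by move=> ? ? [].
have : {subset [seq y <- V | E x y] <= V} by move=> y; rewrite mem_filter => /andP[].
have : uniq [seq y <- V | E x y] by rewrite filter_uniq.
elim: [seq y <- V | E x y] => //= y W IHW /andP[yW uW] sub.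
have yV : y \in V by rewrite sub ?mem_head.
rewrite cat_uniq IHn ?rem_uniq ?size_rem ?sV //= IHW //; last first.
  by move=> z zW; rewrite sub // inE zW orbT.
rewrite andbT; apply/hasPn => s /flattenP[_ /mapP[z zW ->]].
have zV : z \in V by rewrite sub // inE zW orbT.
rewrite /= !mem_spanning_walks ?rem_uniq ?size_rem ?sV //.
case: s => // w s /and3P[/eqP-> _ _].
by apply/negP => /and3P[/eqP zy _ _]; move: yW; rewrite -zy zW.
Qed.

Definition ham_paths E V x y :=
  [seq s <- spanning_walks E (size V).-1 (rem x V) x | last x s == y].

Lemma mem_ham_paths E V x y s : uniq V -> x \in V -> x != y ->
  (s \in ham_paths E V x y) = ham_path E V x y s.
Proof.
move=> uV xV xy; rewrite mem_filter mem_spanning_walks ?rem_uniq ?size_rem //.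
rewrite /ham_path; case: s => [|z t]; first by rewrite /= (negbTE xy) !andbF.
case: (eqVneq z x) => [->|zx] /=; last by rewrite !andbF.
rewrite (permPr (perm_to_rem xV)) perm_cons.
by rewrite andbC -andbA.
Qed.

Lemma uniq_ham_paths E V x y : uniq V -> x \in V -> uniq (ham_paths E V x y).
Proof.
by move=> uV xV; rewrite filter_uniq // uniq_spanning_walks ?rem_uniq ?size_rem.
Qed.

Lemma ham_path_rev E V x y s : symmetric E -> x != y ->
  ham_path E V x y (rev s) = ham_path E V y x s.
Proof.
move=> sE xy; rewrite /ham_path perm_rev rev_sorted.
have -> : sorted (fun z => E^~ z) s = sorted E s.
  by case: s => // z s /=; apply: eq_path => a b; rewrite sE.
case: s => [|z s]; first by rewrite /= (negbTE xy) eq_sym (negbTE xy) !andbF.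
rewrite rev_cons last_rcons; case/lastP: s => [|s w] /=; first by rewrite [(z == y) && _]andbC.
by rewrite rev_rcons last_rcons /= [(z == y) && _]andbC.
Qed.

Lemma path_split_leave E (X : pred T) x t :
  X x -> path E x t -> ~~ all X t ->
  exists a z b, [/\ t = a ++ z :: b, all X a, ~~ X z & E (last x a) z].
Proof.
elim: t x => //= y t IHt x Xx /andP[Exy Et].
case: (boolP (X y)) => [Xy /= nt|nXy _]; last by exists [::], y, t.
have [a [z [b [-> Xa nXz Ez]]]] := IHt y Xy Et nt.
by exists (y :: a), z, b; rewrite /= Xy.
Qed.

(** Otherwise the first step out of [X] would be one of the excluded edges. Only edges between
    vertices of the path matter: in the applications every edge out of [X] ends at a vertex that was
    visited earlier. *)
Lemma path_no_return E (X : pred T) x t :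
  X x -> path E x t ->
  (forall y z, y \in x :: t -> z \in t -> X y -> ~~ X z -> ~~ E y z) -> all X t.
Proof.
move=> Xx Et H; apply: contraT => nt.
have [a [z [b [td Xa nXz Ez]]]] := path_split_leave Xx Et nt.
have Xl : X (last x a) by apply: (allP (_ : all X (x :: a))); rewrite /= ?Xx ?mem_last.
suff: ~~ E (last x a) z by rewrite Ez.
by apply: H => //; rewrite td -?cat_cons mem_cat ?mem_last // mem_head orbT.
Qed.
End HamiltonianPaths.

Lemma ham_path_map (T T' : eqType) (f : T -> T') (E : rel T) (E' : rel T')
    (V s : seq T) (x y : T) :
  injective f -> {in V &, forall a b, E' (f a) (f b) = E a b} ->
  ham_path E' (map f V) (f x) (f y) (map f s) = ham_path E V x y s.
Proof.
move=> fi fE; rewrite /ham_path last_map inj_eq //.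
have -> : head (f y) (map f s) = f (head y s) by case: s.
rewrite inj_eq //.
have -> : perm_eq (map f s) (map f V) = perm_eq s V.
  by apply/idP/idP => [/(perm_map_inj fi)|/(perm_map f)].
case: (boolP (perm_eq s V)) => //= pV; congr andb.
rewrite sorted_map; apply: (@eq_in_sorted _ (mem V)).
  by move=> a b aV bV; exact: fE.
by apply/allP => a; rewrite (perm_mem pV).
Qed.

Lemma eq_in_ham_path (T : eqType) (E E' : rel T) (V s : seq T) (x y : T) :
  {in V &, E =2 E'} -> ham_path E V x y s = ham_path E' V x y s.
Proof.
move=> eE; rewrite -(@ham_path_map _ _ id E' E) //; first by rewrite !map_id.
Qed.

(** * Hamiltonian cycles as edge sets *)

Lemma cycle_edges_rot (G : graph) i (s : seq G) :
  uniq s -> cycle_edges (rot i s) = cycle_edges s.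
Proof.
move=> us; apply/setP => e.
by apply/imsetP/imsetP => -[x xs ->]; exists x; rewrite ?next_rot // ?mem_rot in xs *.
Qed.

Lemma cycle_edges_rev (G : graph) (s : seq G) :
  uniq s -> cycle_edges (rev s) = cycle_edges s.
Proof.
move=> us; apply/setP => e; apply/imsetP/imsetP => -[x xs ->].
  exists (prev s x); first by rewrite mem_prev -mem_rev.
  by rewrite next_rev // next_prev // finset.setUC.
exists (next s x); first by rewrite mem_rev mem_next.
by rewrite next_rev // prev_next // finset.setUC.
Qed.

Lemma nth_next (T : eqType) (x0 : T) (s : seq T) i : uniq s -> i.+1 < size s ->
  next s (nth x0 s i) = nth x0 s i.+1.
Proof.
move=> us lt; rewrite next_nth mem_nth ?(ltnW lt) // index_uniq ?(ltnW lt) //.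
by case: s us lt => //= y s _ lt; apply: set_nth_default.
Qed.

Lemma next_last (T : eqType) (x : T) (t : seq T) : uniq (x :: t) ->
  next (x :: t) (last x t) = x.
Proof.
move=> us; rewrite next_nth mem_last.
rewrite (last_nth x) index_uniq //= ?ltnS // nth_default //.
Qed.

Lemma set2_eq (T : finType) (x y z w : T) :
  [set x; y]%SET = [set z; w]%SET -> (x = z /\ y = w) \/ (x = w /\ y = z).
Proof.
move=> e; have := finset.set21 x y; have := finset.set22 x y.
have := finset.set21 z w; have := finset.set22 z w; rewrite {1 2}e -{1 2}e !inE.
by do 4![case/orP=> /eqP ?]; subst; auto.
Qed.

(* Both sequences traverse the same cycle from the same vertex, and their
   common last vertex fixes the direction. *)
Lemma cycle_edges_inj (G : graph) (x u : G) (s t : seq G) :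
  2 < size s -> size s = size t -> uniq s -> uniq t ->
  head u s = x -> head u t = x -> last x s = u -> last x t = u ->
  cycle_edges s = cycle_edges t -> s = t.
Proof.
move=> s2 st us ut hs ht ls lt est.
have t0 : t = x :: behead t by case: (t) s2 st ht => [|? ?] /=; [lia | move=> _ _ ->].
have h0 : nth x s 0 = x by case: (s) s2 hs.
have lastu : nth x s (size s).-1 = u by rewrite nth_last.
(* The edge of [s] leaving position [j] is an edge of [t] at the same vertex. Were it the edge by
   which [t] enters that vertex, then [s] would return to position [j.-1], or, for [j = 0], its
   second vertex would be the last vertex [u], against [2 < size s]. *)
have step j : j.+1 < size s -> nth x s j = nth x t j ->
    (0 < j -> nth x s j.-1 = nth x t j.-1) -> nth x s j.+1 = nth x t j.+1.
  move=> ltj ej ej'; have ltjt : j.+1 < size t by rewrite -st.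
  have : [set nth x s j; next s (nth x s j)]%SET \in cycle_edges s.
    by apply: imset_f; rewrite mem_nth // ltnW.
  rewrite est nth_next // => /imsetP[y yt] /set2_eq[[<- ->]|[e1 e2]].
    by rewrite ej nth_next.
  case: j => [|i] in ltj ej ej' ltjt e1 e2 *.
    have yu : y = u.
      apply: (can_inj (prev_next ut)); rewrite -e1 h0 -lt.
      by move: ut; rewrite t0 => ut; rewrite next_last.
    have /eqP : nth x s 1 = nth x s (size s).-1 by rewrite lastu e2.
    have lts : (size s).-1 < size s by rewrite prednK // (ltn_trans _ s2).
    by rewrite nth_uniq // => /eqP; lia.
  have yi : y = nth x s i.
    apply: (can_inj (prev_next ut)); rewrite -e1 ej ej' // nth_next //.
    exact: ltnW ltjt.
  have /eqP : nth x s i.+2 = nth x s i by rewrite e2.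
  by rewrite nth_uniq ?(ltnW (ltnW ltj)) // => /eqP; lia.
apply: (@eq_from_nth _ x) => // i; elim/ltn_ind: i => -[|i] IHi lti.
  by rewrite h0 t0.
apply: step => // [|i0]; apply: IHi; lia.
Qed.

(** When every hamiltonian cycle uses the edge between [x] and [u], deleting this edge turns the
    cycles bijectively into the hamiltonian paths from [x] to [u], listed by [S]. *)
Lemma card_hamiltonian_cycles (G : graph) (x u : G) (S : seq (seq G)) :
  2 < #|G| -> x != u -> adj x u -> uniq S ->
  (forall s, (s \in S) = ham_path (@adj G) (enum G) x u s) ->
  (forall t, ucycle (@adj G) (x :: t) -> perm_eq (x :: t) (enum G) ->
     head x t = u \/ last x t = u) ->
  #|hamiltonian_cycles G| = size S.
Proof.
move=> G2 xu axu uS memS edge.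
have size_ham s : s \in S -> size s = #|G| /\ uniq s.
  rewrite memS => /and4P[ps _ _ _]; rewrite (perm_size ps) (perm_uniq ps).
  by rewrite -cardE enum_uniq.
rewrite cardE -(size_map (@cycle_edges G)); apply/perm_size/uniq_perm.
- exact: enum_uniq.
- rewrite map_inj_in_uniq // => s t sS tS.
  have [[zs us] [zt ut]] := (size_ham s sS, size_ham t tS).
  move: sS tS; rewrite !memS => /and4P[_ _ /eqP ? /eqP ?] /and4P[_ _ /eqP ? /eqP ?].
  by apply: (@cycle_edges_inj _ x u); rewrite ?zs ?zt.
move=> C; rewrite mem_enum inE G2 /=; apply/existsP/mapP.
  move=> [s /andP[/andP[cs us] /eqP ->]].
  have ss : size s = #|G| by rewrite size_tuple.
  have xs : x \in (s : seq G).
    apply: contraT => xs; have := max_card (mem (x :: s)).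
    by rewrite (card_uniqP _) /= ?xs // ss ltnn.
  have [i t es] := rot_to xs.
  have ut : uniq (x :: t) by rewrite -es rot_uniq.
  have ct : cycle (@adj G) (x :: t) by rewrite -es rot_cycle.
  have pt : perm_eq (x :: t) (enum G).
    apply: uniq_perm => //; first exact: enum_uniq.
    have sub : {subset x :: t <= enum G} by move=> y _; rewrite mem_enum.
    by apply: (uniq_min_size ut sub _).2; rewrite -cardE -es size_rot ss.
  rewrite -(cycle_edges_rot i) // es.
  have [||hu|lu] := edge t; rewrite ?/ucycle ?ct //.
    (* Here [u] comes right after [x], so the cycle is traversed in the other direction, still
       starting at [x]. *)
    have rr : rot (size t) (rev (x :: t)) = x :: rev t.
      by rewrite rev_cons -cats1 -(size_rev t) rot_size_cat.
    exists (x :: rev t); last first.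
      by rewrite -rr cycle_edges_rot ?cycle_edges_rev ?rev_uniq.
    have : cycle (@adj G) (rot (size t) (rev (x :: t))).
      rewrite rot_cycle rev_cycle; move: ct; rewrite /cycle.
      by apply: sub_path => a b; rewrite adj_sym.
    rewrite rr /= rcons_path => /andP[pr _].
    rewrite memS /ham_path /= pr eqxx -(permPr pt) perm_cons perm_rev perm_refl /=.
    case: t hu {es ut ct pt pr rr} => [ux|_ t /= ->]; first by rewrite -ux eqxx in xu.
    by rewrite rev_cons last_rcons.
  exists (x :: t) => //; rewrite memS /ham_path pt /= eqxx lu eqxx.
  by move: ct; rewrite /= rcons_path => /andP[-> _].
move=> [s sS ->]; have [zs us] := size_ham s sS.
have /eqP zs' := zs.
exists (Tuple zs'); rewrite eqxx andbT /ucycleb us andbT /=.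
move: sS; rewrite memS => /and4P[_ ps hs ls].
case: s {zs us zs'} ps hs ls => // y t /= pt /eqP yx /eqP lt; subst y.
by rewrite rcons_path pt lt adj_sym.
Qed.

(** * The construction *)

Ltac bool_cases :=
  repeat match goal with
    | |- is_true (_ || _) -> _ => case/orP
    | |- is_true (_ && _) -> _ => case/andP
    | |- is_true _ -> _ => move=> ?
    end; try lia.

Section Construction.
(* [B] is a block on the vertices [0, k) whose vertices 0 and k-1 have degree 3.
   The graph on [0, n) consists of the blocks [0, k) and [k, 2k), the vertex 2k,
   and the right part on (2k, n): the graph [R0] on (2k, N) continued by vertices
   j >= N adjacent to j-1 and j-2. *)
Variables (k N : nat) (B R0 : rel nat).

Definition strip_adj : rel nat := fun x y =>
  if (x < N) && (y < N) then R0 x y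
  else [&& x != y, x <= y + 2 & y <= x + 2].

Definition link n : rel nat := fun x y =>
  [|| (x == 0) && (y == 2 * k), (x == k) && (y == 2 * k),
      (x == 2 * k) && (y == (2 * k).+1), (x == k.-1) && (y == n.-1),
      (x == 2 * k) && (y == n.-1) | (x == (2 * k).-1) && (y == n.-2)].

Definition gadget_adj n : rel nat := fun x y =>
  [|| [&& x < k, y < k & B x y],
      [&& k <= x < 2 * k, k <= y < 2 * k & B (x - k) (y - k)],
      [&& 2 * k < x, 2 * k < y & strip_adj x y],
      link n x y | link n y x].

Definition X_paths := ham_paths B (iota 0 k) k.-1 0.
Definition Y_paths := [seq map (addn k) s | s <- ham_paths B (iota 0 k) 0 k.-1].

(* Indexed by [n - N]. *)
Fixpoint R_paths m : seq (seq nat) :=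
  if m is m'.+1 then [seq rcons (rev s) (N + m') | s <- R_paths m']
  else ham_paths R0 (iota (2 * k).+1 (N - (2 * k).+1)) N.-2 N.-1.

(** The paths run from [k.-1] to [n.-1], and the link between these two vertices closes them to
    cycles. The order is: first block, [2 * k], second block, right part. *)
Definition gadget_paths n :=
  [seq a ++ 2 * k :: cd | a <- X_paths,
    cd <- [seq c ++ d | c <- Y_paths, d <- R_paths (n - N)]].

Hypotheses (k2 : 2 <= k) (N4 : 2 * k + 4 <= N).
Hypotheses (Bsym : symmetric B) (R0sym : symmetric R0).

Lemma strip_adj_sym : symmetric strip_adj.
Proof.
move=> x y; rewrite /strip_adj andbC R0sym; case: ifP => // _.
by rewrite eq_sym; congr andb; rewrite andbC.
Qed.

Lemma gadget_adj_sym n : symmetric (gadget_adj n).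
Proof.
move=> x y; rewrite /gadget_adj [link n x y || _]orbC.
congr [|| _, _, _ | _]; rewrite andbCA; do 2 congr andb; first exact: Bsym.
  exact: Bsym.
exact: strip_adj_sym.
Qed.

Ltac gadget_cases := rewrite /gadget_adj /link => ln; bool_cases.

Lemma gadget_X_boundary n x y : N <= n -> gadget_adj n x y -> x < k -> k <= y ->
  (x = 0 /\ y = 2 * k) \/ (x = k.-1 /\ y = n.-1).
Proof. by gadget_cases. Qed.

Lemma gadget_Y_boundary n x y : N <= n -> gadget_adj n x y ->
  k <= x < 2 * k -> ~~ (k <= y < 2 * k) ->
  (x = k /\ y = 2 * k) \/ (x = (2 * k).-1 /\ y = n.-2).
Proof. by gadget_cases. Qed.

Lemma gadget_center_nbr n y : N <= n -> gadget_adj n (2 * k) y ->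
  [|| y == 0, y == k, y == (2 * k).+1 | y == n.-1].
Proof. by gadget_cases. Qed.

Lemma gadget_adj_X n : N <= n -> {in [pred x | x < k] &, gadget_adj n =2 B}.
Proof.
move=> ln x y; rewrite !inE => xk yk.
apply/idP/idP => [|e]; last by rewrite /gadget_adj xk yk e.
by move: ln; gadget_cases.
Qed.

Lemma gadget_adj_Y n x y : N <= n -> x < k -> y < k ->
  gadget_adj n (k + x) (k + y) = B x y.
Proof.
move=> ln xk yk; have lk z : z < k -> k <= k + z < 2 * k by lia.
apply/idP/idP => [|e]; last by rewrite /gadget_adj !lk // !addKn e orbT.
by move: ln; gadget_cases; rewrite -[x](addKn k) -[y](addKn k).
Qed.

Lemma gadget_adj_R n : N <= n ->
  {in [pred x | 2 * k < x] &, gadget_adj n =2 strip_adj}.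
Proof.
move=> ln x y; rewrite !inE => xk yk.
apply/idP/idP => [|e]; last by rewrite /gadget_adj xk yk e !orbT.
by move: ln; gadget_cases.
Qed.

(** * Hamiltonian paths of the three pieces *)

Lemma mem_X_paths s : (s \in X_paths) = ham_path B (iota 0 k) k.-1 0 s.
Proof. by apply: mem_ham_paths; rewrite ?iota_uniq ?mem_iota; lia. Qed.

Lemma mem_Y_paths n s : N <= n ->
  (s \in Y_paths) = ham_path (gadget_adj n) (iota k k) k (2 * k).-1 s.
Proof.
move=> ln; have ek : iota k k = map (addn k) (iota 0 k) by rewrite -iotaDl addn0.
have el : (2 * k).-1 = k + k.-1 by lia.
have mapE t : ham_path (gadget_adj n) (iota k k) k (2 * k).-1 (map (addn k) t) =
              ham_path B (iota 0 k) 0 k.-1 t.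
  rewrite ek el -[X in ham_path _ _ X](addn0 k) (@ham_path_map _ _ _ B) //.
    exact: addnI.
  move=> a b.
  by rewrite !mem_iota => ? ?; apply: gadget_adj_Y.
have memB t : (t \in ham_paths B (iota 0 k) 0 k.-1) = ham_path B (iota 0 k) 0 k.-1 t.
  by apply: mem_ham_paths; rewrite ?iota_uniq ?mem_iota; lia.
apply/mapP/idP => [[t + ->]|hs]; first by rewrite memB mapE.
have es : s = map (addn k) (map (subn^~ k) s).
  rewrite -map_comp -[LHS]map_id; apply/eq_in_map => x.
  by case/and4P: hs => ps _ _ _; rewrite (perm_mem ps) mem_iota /=; lia.
by exists (map (subn^~ k) s); rewrite // memB -mapE -es.
Qed.

(** Within the right part the new vertex [n] has only the neighbours [n.-1] and [n.-2]. A path that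
    starts at [n.-1] and has at least two more vertices before [n] therefore reaches [n] from
    [n.-2]. *)
Lemma R_paths_step n s : N <= n ->
  ham_path strip_adj (iota (2 * k).+1 (n.+1 - (2 * k).+1)) n.-1 n (rcons s n) =
  ham_path strip_adj (iota (2 * k).+1 (n - (2 * k).+1)) n.-1 n.-2 s.
Proof.
move=> ln; have nn : n.-1 != n.-2 by lia.
have ei : iota (2 * k).+1 (n.+1 - (2 * k).+1) = rcons (iota (2 * k).+1 (n - (2 * k).+1)) n.
  rewrite (_ : n.+1 - _ = n - (2 * k).+1 + 1); last lia.
  by rewrite iotaD cats1 subnKC //; lia.
rewrite /ham_path last_rcons eqxx andbT ei -!cats1 perm_cat2r.
case: (boolP (perm_eq _ _)) => //= ps.
case: s ps => [/perm_size|x s ps /=]; first by rewrite size_iota /=; lia.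
rewrite cat_path /= andbT; case: (eqVneq x) ps => [-> ps' /=|]; last by rewrite !andbF.
rewrite andbT; congr andb.
have us : uniq (n.-1 :: s) by rewrite (perm_uniq ps') iota_uniq.
have := mem_last n.-1 s; rewrite (perm_mem ps') mem_iota => lb.
have lx : last n.-1 s != n.-1.
  case: (s) ps' us => [/perm_size|y t _ /=]; first by rewrite size_iota /=; lia.
  by case/andP=> /memPn + _; apply; rewrite mem_last.
by rewrite /strip_adj [n < N]ltnNge ln andbF /=;
  move: (last _ _) lb lx => z lb lx; apply/idP/idP; lia.
Qed.

Lemma mem_R_paths n s : N <= n -> (s \in R_paths (n - N)) =
  ham_path strip_adj (iota (2 * k).+1 (n - (2 * k).+1)) n.-2 n.-1 s.
Proof.
move=> ln; rewrite -(subnKC ln) addKn; elim: (n - N) s => {n ln} [|m IHm] s.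
  rewrite addn0 /= mem_ham_paths ?iota_uniq ?mem_iota; try lia.
  apply: eq_in_ham_path => x y; rewrite !mem_iota /strip_adj => xl yl.
  by rewrite ifT //; lia.
rewrite addnS /=; apply/mapP/idP => [[t + ->]|hs].
  by rewrite IHm R_paths_step ?leq_addr // ham_path_rev //; [exact: strip_adj_sym | lia].
case/lastP: s hs => [|s x hs].
  by case/and4P=> /perm_size; rewrite size_iota /=; lia.
have xE : x = N + m by case/and4P: hs => _ _ _; rewrite last_rcons => /eqP.
move: hs; rewrite xE R_paths_step ?leq_addr // -ham_path_rev //.
- by move=> hs; exists (rev s); rewrite ?revK // IHm.
- exact: strip_adj_sym.
- lia.
Qed.

(** Only two edges leave the first block, one at [0] and one at [k.-1]. The path starts at [k.-1],
    so it uses the second edge at once or leaves through [0]; in the latter case both gates are used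
    up and it cannot come back. *)
Lemma path_leave_X n t : N <= n ->
  path (gadget_adj n) k.-1 t -> uniq (k.-1 :: t) -> ~~ all (fun x => x < k) t ->
  head k.-1 t = n.-1 \/
  exists a b, [/\ t = a ++ 2 * k :: b, all (fun x => x < k) a,
                  last k.-1 a = 0 & all (fun x => k <= x) b].
Proof.
move=> ln pt ut nt; have kk : k.-1 < k by lia.
have [a [z [b [td Xa]]]] := path_split_leave (X := fun x => x < k) kk pt nt.
rewrite -leqNgt => kz Ez.
have lk : last k.-1 a < k.
  by apply: (allP (_ : all (fun x => x < k) (k.-1 :: a))); rewrite /= ?kk ?mem_last.
have [[l0 z2]|[l0 zn]] := gadget_X_boundary ln Ez lk kz; last first.
  (* Leaving from [k.-1] forces [a] to be empty, since the path does not repeat its first vertex. *)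
  left; rewrite td; case: (a) l0 td => //= y c l0 td.
  have kc : k.-1 \in y :: c by rewrite -l0 mem_last.
  by case/andP: ut; rewrite td -cat_cons mem_cat kc.
right; exists a, b; subst z; split => //.
move: pt ut; rewrite td cat_path -cat_cons cat_uniq /=.
move=> /and3P[_ _ pb] /and3P[/andP[ka _] /norP[_ /hasPn disj] _].
(* A return would enter the block at [0] or at [k.-1], both visited before. *)
apply: (path_no_return kz pb) => y w yb wb ky; rewrite -ltnNge => wk.
apply/negP; rewrite gadget_adj_sym => Ewy.
have := disj w wb; rewrite /= inE.
have [[-> _]|[-> _]] := gadget_X_boundary ln Ewy wk ky; last by rewrite eqxx.
by rewrite -l0 -in_cons mem_last.
Qed.

(** If the cycle does not go directly from [k.-1] to [n.-1], it leaves the first block through [0]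
    and stays outside, so its closing edge enters the block at [k.-1]. As [k.-1] is not [0], that
    edge comes from [n.-1]. *)
Lemma gadget_cycle_edge n t : N <= n ->
  cycle (gadget_adj n) (k.-1 :: t) -> perm_eq (k.-1 :: t) (iota 0 n) ->
  head k.-1 t = n.-1 \/ last k.-1 t = n.-1.
Proof.
move=> ln; rewrite /= rcons_path => /andP[pt El] pn.
have ut : uniq (k.-1 :: t) by rewrite (perm_uniq pn) iota_uniq.
have nt : ~~ all (fun x => x < k) t.
  apply/allPn; exists n.-1; last by lia.
  have : n.-1 \in k.-1 :: t by rewrite (perm_mem pn) mem_iota; lia.
  by rewrite inE; case: eqP => // ?; lia.
have [|[a [b [td _ _ kb]]]] := path_leave_X ln pt ut nt; [by left|right].
have kl : k <= last k.-1 t.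
  rewrite td last_cat /=; have := mem_last (2 * k) b; rewrite inE => /orP[/eqP->|]; first lia.
  by move/(allP kb).
move: El; rewrite gadget_adj_sym => El.
by have := gadget_X_boundary ln El _ kl; lia.
Qed.

(** The second block has two gates, [k] towards [2 * k] and [(2 * k).-1] towards [n.-2]. After
    [2 * k] the path has to enter at [k], cross the block and continue at [n.-2], after which no
    gate is left for a return. *)
Lemma gadget_path_split n b : N <= n ->
  path (gadget_adj n) (2 * k) b -> perm_eq b (iota k k ++ iota (2 * k).+1 (n - (2 * k).+1)) ->
  last (2 * k) b = n.-1 ->
  exists c d, [/\ b = c ++ d, ham_path (gadget_adj n) (iota k k) k (2 * k).-1 c &
    ham_path strip_adj (iota (2 * k).+1 (n - (2 * k).+1)) n.-2 n.-1 d].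
Proof.
move=> ln; set Y := fun x => k <= x < 2 * k.
have memV x : (x \in iota k k ++ iota (2 * k).+1 (n - (2 * k).+1)) =
              Y x || (2 * k < x < n).
  by rewrite mem_cat !mem_iota /Y; lia.
case: b => [|y b pb pn lb]; first by move=> _ /perm_size; rewrite size_cat size_iota /=; lia.
have ub : uniq (y :: b).
  rewrite (perm_uniq pn) cat_uniq !iota_uniq /= andbT.
  by apply/hasPn => x; rewrite !mem_iota /=; lia.
have memb x : (x \in y :: b) = Y x || (2 * k < x < n) by rewrite (perm_mem pn) memV.
have nb : 2 * k \notin y :: b by rewrite memb /Y; lia.
move: pb lb => /= /andP[Ey pb] lb.
have yb : Y y || (2 * k < y < n) by rewrite -memb mem_head.
have lY : ~~ Y n.-1 by rewrite /Y; lia.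
have vY : ~~ Y n.-2 by rewrite /Y; lia.
have ky : y = k.
  (* If the path starts elsewhere, it enters the block later and leaves it again, because it ends at
     [n.-1]. Without [2 * k] both crossings use the edge at [n.-2], which would be visited twice. *)
  apply/eqP; apply: contraT => yk; exfalso.
  have nYy : ~~ Y y.
    have := gadget_center_nbr ln Ey; rewrite /Y in yb *; lia.
  have kb : k \in b.
    have : k \in y :: b by rewrite memb /Y; lia.
    by rewrite inE eq_sym (negbTE yk).
  have nall : ~~ all (fun x => ~~ Y x) b.
    by apply/allPn; exists k => //; rewrite /Y; lia.
  have [c [w [d [bd Yc]]]] := path_split_leave (X := fun x => ~~ Y x) nYy pb nall.
  rewrite negbK gadget_adj_sym => Yw Ew.
  have lc : ~~ Y (last y c).
    by apply: (allP (_ : all (fun x => ~~ Y x) (y :: c))); rewrite /= ?nYy ?mem_last.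
  have lin := mem_last y c.
  have yd : y :: b = (y :: c) ++ w :: d by rewrite bd.
  have [[_ l2]|[w2 lv]] := gadget_Y_boundary ln Ew Yw lc.
    by move: nb; rewrite yd mem_cat -l2 lin.
  have pd : path (gadget_adj n) w d by move: pb; rewrite bd cat_path /= => /and3P[].
  have ld : last w d = n.-1 by rewrite -lb bd last_cat.
  have nall2 : ~~ all Y d.
    apply/allPn; exists n.-1 => //; have := mem_last w d; rewrite ld inE => /orP[/eqP e|//].
    by rewrite e Yw in lY.
  have [e [z [f [dd Ye nYz Ez]]]] := path_split_leave Yw pd nall2.
  have Yle : Y (last w e).
    by apply: (allP (_ : all Y (w :: e))); rewrite /= ?Yw ?mem_last.
  have zb : z \in w :: d by rewrite dd inE mem_cat mem_head !orbT.
  have [[_ z2]|[_ zv]] := gadget_Y_boundary ln Ez Yle nYz.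
    by move: nb; rewrite yd mem_cat -z2 zb orbT.
  move: ub; rewrite yd cat_uniq => /and3P[_ /hasPn/(_ _ zb) /negP[]].
  by rewrite zv -lv lin.
subst y; have Yk : Y k by rewrite /Y; lia.
have nall : ~~ all Y b.
  apply/allPn; exists n.-1 => //; have := mem_last k b; rewrite lb inE => /orP[/eqP e|//].
  by rewrite e Yk in lY.
(* The first exit from the block goes from [(2 * k).-1] to [n.-2], as [2 * k] does not occur
   again. *)
have [c [z [d [bd Yc nYz Ez]]]] := path_split_leave Yk pb nall.
have Ylc : Y (last k c).
  by apply: (allP (_ : all Y (k :: c))); rewrite /= ?Yk ?mem_last.
have kd : k :: b = (k :: c) ++ z :: d by rewrite bd.
have [[_ z2]|[lc zv]] := gadget_Y_boundary ln Ez Ylc nYz.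
  by move: nb; rewrite kd mem_cat -z2 mem_head orbT.
move: pb; rewrite bd cat_path /= => /and3P[pc _ pd].
move: ub; rewrite kd cat_uniq => /and3P[uc /hasPn disj ud].
have nYd : all (fun x => ~~ Y x) d.
  apply: (path_no_return (X := fun x => ~~ Y x) nYz pd) => x w xd wd nYx; rewrite negbK => Yw.
  apply/negP; rewrite gadget_adj_sym => Ewx.
  have [[_ x2]|[w2 _]] := gadget_Y_boundary ln Ewx Yw nYx.
    by move: nb; rewrite kd mem_cat -x2 xd orbT.
  have := disj w; rewrite inE wd orbT => /(_ isT) /negP[].
  by rewrite /= w2 -lc mem_last.
exists (k :: c), (z :: d); split => //.
  rewrite /ham_path /= eqxx lc eqxx pc !andbT.
  apply: uniq_perm => //; first exact: iota_uniq.
  move=> x; rewrite mem_iota.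
  have -> : (k <= x < k + k) = Y x by rewrite /Y mul2n -addnn.
  apply/idP/idP => [xc|Yx].
    by apply: (allP (_ : all Y (k :: c))) => //=; rewrite Yk.
  have : x \in k :: b by rewrite memb Yx.
  rewrite kd mem_cat => /orP[//|xd].
  have : ~~ Y x by apply: (allP (_ : all (fun x => ~~ Y x) (z :: d))) => //=; rewrite nYz.
  by rewrite Yx.
rewrite /ham_path /= zv eqxx.
have -> : last n.-2 d == n.-1 by rewrite -zv -lb bd last_cat.
rewrite !andbT -zv.
have memd x : (x \in z :: d) = (2 * k < x < n).
  apply/idP/idP => [xd|xR].
    have : ~~ Y x by apply: (allP (_ : all (fun x => ~~ Y x) (z :: d))) => //=; rewrite nYz.
    have : x \in k :: b by rewrite kd mem_cat xd orbT.
    by rewrite memb => /orP[->|].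
  have : x \in k :: b by rewrite memb xR orbT.
  rewrite kd mem_cat => /orP[xc|//].
  have : Y x by apply: (allP (_ : all Y (k :: c))) => //=; rewrite Yk.
  by case/andP: xR => /ltnW xR _; rewrite /Y ltnNge xR andbF.
apply/andP; split.
  apply: uniq_perm => //; first exact: iota_uniq.
  by move=> x; rewrite memd mem_iota subnKC //; apply: leq_trans ln; clear -N4; lia.
rewrite -(@eq_in_path _ [pred x | 2 * k < x] (gadget_adj n)) //.
  exact: gadget_adj_R.
by apply/allP => x; rewrite memd inE => /andP[].
Qed.

(** * Hamiltonian paths of the whole graph *)

Lemma gadget_vertices n : N <= n ->
  perm_eq (iota 0 n)
    (iota 0 k ++ 2 * k :: iota k k ++ iota (2 * k).+1 (n - (2 * k).+1)).
Proof.
move=> ln; set m := n - _; have -> : n = k + (k + (1 + m)) by rewrite /m; lia.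
rewrite !iotaD !add0n perm_cat2l perm_sym -cat1s perm_catCA perm_cat2l.
by rewrite mul2n -addnn addn1.
Qed.

(** Concatenated pieces form a path because consecutive pieces are joined by links. Conversely,
    [path_leave_X] cuts off the piece in the first block and [gadget_path_split] cuts the rest. *)
Lemma mem_gadget_paths n s : N <= n ->
  (s \in gadget_paths n) = ham_path (gadget_adj n) (iota 0 n) k.-1 n.-1 s.
Proof.
move=> ln; have eR x y d : ham_path (gadget_adj n) (iota (2 * k).+1 (n - (2 * k).+1)) x y d =
    ham_path strip_adj (iota (2 * k).+1 (n - (2 * k).+1)) x y d.
  apply: eq_in_ham_path => a b; rewrite !mem_iota => /andP[? _] /andP[? _].
  exact: gadget_adj_R.
have eX x y d : ham_path (gadget_adj n) (iota 0 k) x y d = ham_path B (iota 0 k) x y d.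
  by apply: eq_in_ham_path => a b; rewrite !mem_iota => ? ?; apply: gadget_adj_X.
rewrite /ham_path (permPr (gadget_vertices ln)).
apply/allpairsP/and4P => [[[a cd] /= [aX + ->]]|].
  case/allpairsP => -[c d] /= [cY dR ->].
  move: aX cY dR; rewrite mem_X_paths (mem_Y_paths _ ln) mem_R_paths // -eX -eR.
  move=> /and4P[pa sa ha la] /and4P[pc sc hc lc] /and4P[pd sd hd ld].
  case: a pa sa ha la => [/perm_size|x a pa]; first by rewrite size_iota /=; lia.
  case: c pc sc hc lc => [/perm_size|y c pc]; first by rewrite size_iota /=; lia.
  case: d pd sd hd ld => [/perm_size|z d pd]; first by rewrite size_iota /=; lia.
  move=> /= sd /eqP zE /eqP ld sc /eqP yE /eqP lc sa /eqP xE /eqP la; subst x y z.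
  split; rewrite ?eqxx //.
  - by apply: (perm_cat pa); rewrite perm_cons; apply: (perm_cat pc pd).
  - rewrite !cat_path sa la /= cat_path lc /= sc sd !andbT.
    by rewrite /gadget_adj /link !eqxx !andbT /= !orbT.
  by rewrite last_cat /= last_cat /= ld.
move=> [ps]; case: s ps => [/perm_size|x t pn /= pt /eqP xE /eqP lt].
  by rewrite size_cat size_iota /=; lia.
subst x; have ut : uniq (k.-1 :: t).
  by rewrite (perm_uniq pn) -(perm_uniq (gadget_vertices ln)) iota_uniq.
have st : (size t).+1 = n.
  by rewrite -[LHS]/(size (k.-1 :: t)) (perm_size pn) -(perm_size (gadget_vertices ln)) size_iota.
have memt x : (x \in k.-1 :: t) = (x < n).
  by rewrite (perm_mem pn) -(perm_mem (gadget_vertices ln)) mem_iota.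
have nt : ~~ all (fun x => x < k) t.
  apply/allPn; exists n.-1; last by lia.
  have := mem_last k.-1 t; rewrite lt inE => /orP[/eqP|//]; lia.
have [hu|[a [b [td Xa l0 kb]]]] := path_leave_X ln pt ut nt.
  (* The last vertex [n.-1] cannot also be the second one. *)
  case: t hu lt ut st {pn pt memt nt} => [|y t /= -> lt]; first by move=> /=; lia.
  case: t lt => [|z t lt /and3P[_]]; first by move=> _ _ /=; lia.
  by rewrite -[X in X \notin _]lt /= mem_last.
have td' : k.-1 :: t = (k.-1 :: a) ++ 2 * k :: b by rewrite td.
move: (pt) ut; rewrite td cat_path -cat_cons cat_uniq => /andP[pa /= /andP[_ pb]].
move=> /and3P[ua _ /andP[nb ub]].
have pA : perm_eq (k.-1 :: a) (iota 0 k).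
  apply: uniq_perm => //; first exact: iota_uniq.
  move=> x; rewrite mem_iota add0n leq0n andTb; apply/idP/idP => [xa|xk].
    apply: (allP (_ : all (fun x => x < k) (k.-1 :: a))) => //=.
    by rewrite Xa andbT; clear -k2; lia.
  have : x \in k.-1 :: t by rewrite memt; clear -k2 N4 ln xk; lia.
  rewrite td' mem_cat => /orP[//|]; rewrite inE => /orP[/eqP|/(allP kb)]; clear -xk; lia.
have pB : perm_eq b (iota k k ++ iota (2 * k).+1 (n - (2 * k).+1)).
  by move: pn; rewrite td' (permPl (perm_cat pA (perm_refl _))) perm_cat2l perm_cons.
have [|c [d [bd hc hd]]] := gadget_path_split ln pb pB.
  by rewrite -lt td last_cat.
exists (k.-1 :: a, b); split => //=.
  by rewrite mem_X_paths -eX /ham_path pA /= pa l0 !eqxx.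
apply/allpairsP; exists (c, d); split => //=; first by rewrite (mem_Y_paths _ ln).
by rewrite mem_R_paths.
Qed.

Lemma size_R_paths m : size (R_paths m) = size (R_paths 0).
Proof. by elim: m => //= m <-; rewrite size_map. Qed.

Lemma size_gadget_paths n :
  size (gadget_paths n) = size X_paths * (size Y_paths * size (R_paths 0)).
Proof. by rewrite !size_allpairs size_R_paths. Qed.

Lemma uniq_R_paths m : uniq (R_paths m).
Proof.
elim: m => [|m IHm] /=; first by rewrite uniq_ham_paths ?iota_uniq ?mem_iota; lia.
by rewrite map_inj_uniq // => s t /rcons_inj[/(can_inj revK)].
Qed.

(** The pieces in the two blocks all have length [k], so a concatenation determines its pieces. *)
Lemma uniq_gadget_paths n : N <= n -> uniq (gadget_paths n).
Proof.
move=> ln; have sX a : a \in X_paths -> size a = k.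
  by rewrite mem_X_paths => /and4P[/perm_size->]; rewrite size_iota.
have sY c : c \in Y_paths -> size c = k.
  by rewrite (mem_Y_paths _ ln) => /and4P[/perm_size->]; rewrite size_iota.
apply: allpairs_uniq.
- by rewrite uniq_ham_paths ?iota_uniq ?mem_iota; lia.
- apply: allpairs_uniq; last 1 first.
  + move=> [a b] [c d] /allpairsP[[? ?] /= [/sY sa _ [-> ->]]].
    move=> /allpairsP[[? ?] /= [/sY sc _ [-> ->]]].
    by move/eqP; rewrite eqseq_cat ?sa ?sc // => /andP[/eqP-> /eqP->].
  + rewrite map_inj_uniq ?uniq_ham_paths ?iota_uniq ?mem_iota //; first lia.
    by apply: inj_map; apply: addnI.
  + exact: uniq_R_paths.
move=> [a b] [c d] /allpairsP[[? ?] /= [/sX sa _ [-> ->]]] /allpairsP[[? ?] /= [/sX sc _ [-> ->]]].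
by move/eqP; rewrite eqseq_cat ?sa ?sc // eqseq_cons => /and3P[/eqP-> _ /eqP->].
Qed.

(** * Regularity *)

Hypothesis degB : forall x, x < k ->
  count (B x) (iota 0 k) + (x == 0) + (x == k.-1) = 4.
Hypothesis degR0 : forall x, 2 * k < x < N ->
  count (R0 x) (iota (2 * k).+1 (N - (2 * k).+1)) +
    (x == (2 * k).+1) + (x == N.-1).*2 + (x == N.-2) = 4.

(** The extra summands count links: one at [(2 * k).+1], two at [n.-1], one at [n.-2]. When the
    vertex [n] is added, [n.-1] and [n.-2] each lose one link and gain an edge to [n], while [n]
    itself has two edges and two links. *)
Lemma count_strip n x : N <= n -> 2 * k < x < n ->
  count (strip_adj x) (iota (2 * k).+1 (n - (2 * k).+1)) +
    (x == (2 * k).+1) + (x == n.-1).*2 + (x == n.-2) = 4.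
Proof.
move=> ln; rewrite -(subnKC ln); elim: (n - N) x => {n ln} [|m IHm] x.
  rewrite addn0 => xN; rewrite -[RHS](degR0 xN); do 3 congr addn.
  apply: eq_in_count => y; rewrite mem_iota /strip_adj => yN.
  by rewrite ifT //; lia.
rewrite addnS; set n := N + m in IHm *.
have ln : N <= n by rewrite leq_addr.
have strip_n y : y <= n -> strip_adj n y = (y == n.-1) || (y == n.-2).
  by rewrite /strip_adj ltnNge ln /=; lia.
rewrite (_ : n.+1 - _ = (n - (2 * k).+1 - 2) + 2 + 1); last lia.
move=> /andP[xk]; rewrite ltnS leq_eqVlt => /orP[/eqP->|xn].
  rewrite !iotaD !count_cat /=.
  rewrite (@eq_in_count _ _ pred0) => [|y]; last first.
    by rewrite mem_iota => yl; rewrite strip_n /=; lia.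
  rewrite count_pred0 !strip_n; lia.
rewrite iotaD count_cat /= subnK; last lia.
have := IHm x; rewrite xk xn => /(_ isT).
rewrite subnKC; last lia.
rewrite strip_adj_sym // strip_n; last lia.
by move: (count _ _) => c; lia.
Qed.

Lemma count_iota_eq b c m l : m <= c < m + l ->
  count (fun y => b && (y == c)) (iota m l) = b.
Proof.
move=> cl; case: b; last by rewrite count_pred0.
rewrite (eq_count (a2 := pred1 c)) //.
by rewrite count_uniq_mem ?iota_uniq // mem_iota cl.
Qed.

Lemma link_gadget n x y : link n x y -> gadget_adj n x y.
Proof. by rewrite /gadget_adj => ->; rewrite !orbT. Qed.

Lemma count_gadget n x : N <= n -> x < n -> count (gadget_adj n x) (iota 0 n) = 4.
Proof.
move=> ln xn; rewrite (permP (gadget_vertices ln)) count_cat /= count_cat.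
have [xk|kx] := ltnP x k.
  rewrite (@eq_in_count _ _ (B x)) => [|y]; last first.
    by rewrite mem_iota => yk; apply: gadget_adj_X.
  rewrite [count _ (iota k k)](@eq_in_count _ _ pred0) => [|y]; last first.
    by rewrite mem_iota => yk; apply/negbTE/negP => h; move: ln h; gadget_cases.
  rewrite [count _ (iota _.+1 _)](@eq_in_count _ _
    (fun y => (x == k.-1) && (y == n.-1))); last first.
    move=> y; rewrite mem_iota => yk; apply/idP/idP; first by move: ln; gadget_cases.
    by move=> h; apply: link_gadget; rewrite /link h !orbT.
  rewrite count_pred0 count_iota_eq; last lia.
  have -> : gadget_adj n x (2 * k) = (x == 0).
    apply/idP/idP; first by move: ln; gadget_cases.
    by move=> h; apply: link_gadget; rewrite /link h eqxx.
  by rewrite -[RHS](degB xk) add0n addnA.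
have [x2|] := eqVneq x (2 * k).
  subst x.
  rewrite (@eq_in_count _ _ (fun y => true && (y == 0))) => [|y]; last first.
    rewrite mem_iota => yk; apply/idP/idP; first by move: ln; gadget_cases.
    move=> h; rewrite gadget_adj_sym; apply: link_gadget.
    by rewrite /link (eqP h) !eqxx.
  rewrite [count _ (iota k k)](@eq_in_count _ _ (fun y => true && (y == k))) => [|y]; last first.
    rewrite mem_iota => yk; apply/idP/idP; first by move: ln; gadget_cases.
    move=> h; rewrite gadget_adj_sym; apply: link_gadget.
    by rewrite /link (eqP h) !eqxx orbT.
  rewrite [count _ (iota _.+1 _)](@eq_in_count _ _ (predU (fun y => true && (y == (2 * k).+1))
      (fun y => true && (y == n.-1)))) => [|y]; last first.
    rewrite mem_iota => yk; apply/idP/idP; first by move: ln => /=; gadget_cases.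
    by move=> /= h; apply: link_gadget; rewrite /link eqxx /=; case/orP: h => ->; rewrite !orbT.
  have -> : gadget_adj n (2 * k) (2 * k) = false.
    by apply/negbTE/negP => h; move: ln h; gadget_cases.
  rewrite !count_iota_eq; try lia.
  set a1 := (fun y => true && (y == (2 * k).+1)); set a2 := (fun y => true && (y == n.-1)).
  (* Inclusion-exclusion: the two neighbours of [2 * k] in the right part are distinct. *)
  have := count_predUI a1 a2 (iota (2 * k).+1 (n - (2 * k).+1)).
  rewrite [count (predI _ _) _](@eq_in_count _ _ pred0) => [|y]; last first.
    by rewrite mem_iota /a1 /a2 /= => yk; lia.
  by rewrite count_pred0 !count_iota_eq; lia.
have [xY xk|yx xk] := ltnP x (2 * k).
  rewrite (@eq_in_count _ _ pred0) => [|y]; last first.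
    by rewrite mem_iota => yk; apply/negbTE/negP => h; move: ln h; gadget_cases.
  rewrite [count _ (iota k k)](_ : _ = count (B (x - k)) (iota 0 k)); last first.
    rewrite -[X in iota X k](addn0 k) iotaDl count_map; apply: eq_in_count => y.
    rewrite mem_iota => yk /=; rewrite -{1}(subnKC kx) gadget_adj_Y //; lia.
  rewrite [count _ (iota _.+1 _)](@eq_in_count _ _
    (fun y => (x == (2 * k).-1) && (y == n.-2))); last first.
    move=> y; rewrite mem_iota => yk; apply/idP/idP; first by move: ln; gadget_cases.
    by move=> h; apply: link_gadget; rewrite /link h !orbT.
  rewrite count_pred0 count_iota_eq; last lia.
  have -> : gadget_adj n x (2 * k) = (x == k).
    apply/idP/idP; first by move: ln; gadget_cases.
    by move=> h; apply: link_gadget; rewrite /link h eqxx orbT.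
  rewrite -(degB (_ : x - k < k)); last lia.
  by move: (count _ _) => c; lia.
rewrite (@eq_in_count _ _ (fun y => (x == n.-1) && (y == k.-1))) => [|y]; last first.
  rewrite mem_iota => yk; apply/idP/idP; first by move: ln; gadget_cases.
  move=> h; rewrite gadget_adj_sym; apply: link_gadget; rewrite /link andbC in h *.
  by rewrite h !orbT.
rewrite [count _ (iota k k)](@eq_in_count _ _
  (fun y => (x == n.-2) && (y == (2 * k).-1))); last first.
  move=> y; rewrite mem_iota => yk; apply/idP/idP; first by move: ln; gadget_cases.
  by move=> h; case/andP: h => /eqP-> /eqP->; rewrite gadget_adj_sym; apply: link_gadget;
  rewrite /link !eqxx !orbT.
rewrite [count _ (iota _.+1 _)](@eq_in_count _ _ (strip_adj x)); last first.
  by move=> y; rewrite mem_iota => yk; apply: gadget_adj_R => //; rewrite inE; lia.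
have -> : gadget_adj n x (2 * k) = (x == (2 * k).+1) || (x == n.-1).
  apply/idP/idP; first by move: ln; gadget_cases.
  move=> h; rewrite gadget_adj_sym; apply: link_gadget; rewrite /link eqxx /=.
  by case/orP: h => ->; rewrite !orbT.
rewrite !count_iota_eq; try lia.
have := @count_strip n x ln; rewrite xn andbT => /(_ _)/esym ->; last lia.
by move: (count _ _) => c; lia.
Qed.

(** * The graph and its number of hamiltonian cycles *)

Hypotheses (Birr : irreflexive B) (R0irr : irreflexive R0).

Lemma gadget_adj_irrefl n : N <= n -> irreflexive (gadget_adj n).
Proof.
move=> ln x; have sI : strip_adj x x = false.
  by rewrite /strip_adj R0irr eqxx; case: ifP.
apply/negbTE/negP => h; move: ln h; gadget_cases; congruence.
Qed.

Definition gadget_graph n (ln : N <= n) : graph :=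
  @Graph 'I_n (fun x y => gadget_adj n x y)
    (fun x y => gadget_adj_sym n x y) (fun x => gadget_adj_irrefl ln x).

Lemma gadget_graph_regular n (ln : N <= n) : regular_graph 4 (gadget_graph ln).
Proof.
move=> x; rewrite cardsE cardE /enum_mem size_filter -enumT.
rewrite -(count_gadget ln (ltn_ord x)) -val_enum_ord count_map.
by apply: eq_count.
Qed.

(** By [gadget_cycle_edge] every hamiltonian cycle contains the edge from [k.-1] to [n.-1], so the
    cycles are counted by the paths in [gadget_paths]. *)
Lemma card_gadget_cycles n (ln : N <= n) :
  #|hamiltonian_cycles (gadget_graph ln)| =
  size X_paths * (size Y_paths * size (R_paths 0)).
Proof.
have kn : k.-1 < n by lia.
have un : n.-1 < n by lia.
pose x : gadget_graph ln := Ordinal kn; pose u : gadget_graph ln := Ordinal un.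
(* The default [x] is never reached on the paths considered, whose entries are all below [n]. *)
pose ordS (t : seq nat) : seq (gadget_graph ln) := map (insubd x) t.
have ordSK t : t \in gadget_paths n -> map val (ordS t) = t.
  rewrite mem_gadget_paths // => /and4P[pt _ _ _].
  rewrite -map_comp -[RHS]map_id; apply/eq_in_map => i.
  by rewrite (perm_mem pt) mem_iota => /= il; rewrite val_insubd ifT.
have hamE s : ham_path (@adj (gadget_graph ln)) (enum (gadget_graph ln)) x u s =
              (map val s \in gadget_paths n).
  rewrite mem_gadget_paths // -val_enum_ord.
  by rewrite -(@ham_path_map _ _ val (@adj (gadget_graph ln)) (gadget_adj n)) //; exact: val_inj.
rewrite -(size_gadget_paths n) -(size_map ordS).
apply: (@card_hamiltonian_cycles _ x u).
- by rewrite card_ord; lia.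
- by rewrite -val_eqE /=; lia.
- by apply: link_gadget; rewrite /link !eqxx !orbT.
- rewrite map_inj_in_uniq ?uniq_gadget_paths // => s t sP tP e.
  by rewrite -(ordSK s sP) e ordSK.
- move=> s; rewrite hamE; apply/mapP/idP => [[t tP ->]|sP]; first by rewrite ordSK.
  exists (map val s) => //; rewrite /ordS -map_comp -[LHS]map_id.
  by apply/eq_map => i /=; rewrite valKd.
move=> t /andP[ct _] pt.
have cv : cycle (gadget_adj n) (k.-1 :: map val t).
  by rewrite -[k.-1]/(val x) /cycle -map_rcons path_map.
have pv : perm_eq (k.-1 :: map val t) (iota 0 n).
  by rewrite -val_enum_ord -[k.-1 :: _]/(map val (x :: t)); apply: perm_map.
have [h|] := gadget_cycle_edge ln cv pv.
  by left; apply: val_inj; case: (t) h.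
by rewrite -[k.-1]/(val x) last_map => h; right; apply: val_inj.
Qed.

(** A positive count gives a hamiltonian cycle, and this cycle connects all vertices. *)
Lemma gadget_graph_connected n (ln : N <= n) :
  0 < size X_paths * (size Y_paths * size (R_paths 0)) ->
  connected_graph (gadget_graph ln).
Proof.
rewrite -(card_gadget_cycles ln) => /card_gt0P[C]; rewrite inE => /andP[_].
case/existsP=> s /andP[/andP[cs us] _] x y.
have inS z : z \in (s : seq (gadget_graph ln)).
  apply: contraT => zs; have := max_card (mem (z :: s)).
  by rewrite (card_uniqP _) /= ?zs // size_tuple ltnn.
exact: connect_cycle cs _ _ (inS x) (inS y).
Qed.

End Construction.

(** * Straight-line drawings *)

Import Order.TTheory GRing.Theory Num.Theory.
Import numFieldNormedType.Exports.
Local Open Scope ring_scope.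

Section Segments.
Variable R : realType.
Implicit Types (a b c d p : R * R).

Definition seg_point a b (t : R) : R * R :=
  ((1 - t) * a.1 + t * b.1, (1 - t) * a.2 + t * b.2).

Definition seg a b p := exists2 t : R, 0 <= t <= 1 & p = seg_point a b t.

Lemma seg_sym a b p : seg a b p -> seg b a p.
Proof.
case=> t /andP[t0 t1] ->; exists (1 - t); first by apply/andP; split; lra.
by rewrite /seg_point; congr pair; ring.
Qed.

Lemma seg_is_arc a b : a != b -> is_arc a b (seg a b).
Proof.
move=> ab; exists (seg_point a b); split.
- apply: continuous_subspaceT => t.
  have comb (c d : R) :
      ((1 - x) * c + x * d @[x --> t] --> (1 - t) * c + t * d)%classic.
    apply: cvgD; apply: cvgM; try exact: cvg_cst; last exact: cvg_id.
    by apply: cvgB; [exact: cvg_cst | exact: cvg_id].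
  exact: cvg_pair (comb a.1 b.1) (comb a.2 b.2).
- move=> s t _ _ [e1 e2]; apply/eqP; rewrite -subr_eq0; apply: contraT => st.
  case/eqP: ab; rewrite [a]surjective_pairing [b]surjective_pairing; congr pair.
    apply: (mulfI st); apply/eqP; rewrite -subr_eq0; apply/eqP.
    transitivity (((1 - t) * a.1 + t * b.1) - ((1 - s) * a.1 + s * b.1)); first ring.
    by rewrite e1 subrr.
  apply: (mulfI st); apply/eqP; rewrite -subr_eq0; apply/eqP.
  transitivity (((1 - t) * a.2 + t * b.2) - ((1 - s) * a.2 + s * b.2)); first ring.
  by rewrite e2 subrr.
- by rewrite /seg_point subr0 !mul1r !mul0r !addr0 -surjective_pairing.
- by rewrite /seg_point subrr !mul1r !mul0r !add0r -surjective_pairing.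
apply/seteqP; split => p /=.
  by case=> t t01 ->; exists t => //; rewrite in_itv.
by case=> t; rewrite in_itv /= => t01 <-; exists t.
Qed.

(* The line [u x + v y + w = 0] separates the segments and meets [seg c d] at
   most in [c]. *)
Lemma seg_separate (u v w : R) a b c d p :
  let f (z : R * R) := u * z.1 + v * z.2 + w in
  f a <= 0 -> f b <= 0 -> 0 <= f c -> 0 < f d ->
  seg a b p -> seg c d p -> p = c /\ f c = 0.
Proof.
move=> f fa fb fc fd [t /andP[t0 t1] ->] [s /andP[s0 s1] e].
have fE q r (h : R) : f (seg_point q r h) = (1 - h) * f q + h * f r.
  by rewrite /f /seg_point /=; ring.
have : f (seg_point a b t) <= 0 by rewrite fE; nra.
rewrite e fE => fs.
have s00 : s = 0 by nra.
have fc0 : f c = 0 by move: fs; rewrite s00; lra.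
split; last exact: fc0.
by rewrite s00 /seg_point subr0 !mul1r !mul0r !addr0 -surjective_pairing.
Qed.

(** The form [f] is nonnegative on the segment and vanishes at [c]; if [f a] is positive, this is
    possible only with all the weight on [b]. *)
Lemma seg_extreme (u v w : R) a b c :
  let f (z : R * R) := u * z.1 + v * z.2 + w in
  0 <= f a -> 0 <= f b -> f c = 0 ->
  (f a = 0 -> a = c) -> seg a b c -> a = c \/ b = c.
Proof.
move=> f fa fb fc ha [t /andP[t0 t1] e].
have fE : f c = (1 - t) * f a + t * f b by rewrite e /f /seg_point /=; ring.
have [fa0|fa0] := eqVneq (f a) 0; first by left; apply: ha.
right; have t1' : t = 1.
  by apply/eqP; move: fa0; apply: contra_neqT => ?; nra.
by rewrite e t1' /seg_point subrr !mul1r !mul0r !add0r -surjective_pairing.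
Qed.

Definition meet_at_ends (T : eqType) (pos : T -> R * R) (x y z w : T) :=
  forall p, seg (pos x) (pos y) p -> seg (pos z) (pos w) p ->
    exists2 v, (v \in [:: x; y]) && (v \in [:: z; w]) & p = pos v.

(** That no edge runs through a foreign vertex follows from the condition on pairs of edges, as each
    vertex has an incident edge. *)
Lemma straight_line_planar (G : graph) (pos : G -> R * R) :
  injective pos -> (forall x : G, exists y, adj x y) ->
  (forall x y z w : G, adj x y -> adj z w -> [set x; y]%SET != [set z; w]%SET ->
     meet_at_ends pos x y z w) ->
  planar R G.
Proof.
move=> ipos deg meet.
pose curve (E : {set G}) : set (R * R) :=
  fun p => exists x y, E = [set x; y]%SET /\ seg (pos x) (pos y) p.
have curveE x y : curve [set x; y]%SET = seg (pos x) (pos y).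
  apply/seteqP; split => p; last by move=> h; exists x, y.
  by case=> z [w [/set2_eq[[-> ->]|[-> ->]]]] // /seg_sym.
have edgeP (E : {set G}) : E \in edges G -> exists x y, adj x y /\ E = [set x; y]%SET.
  by rewrite inE => /existsP[x /existsP[y /andP[xy /eqP->]]]; exists x, y.
have cross (E F : {set G}) p : E \in edges G -> F \in edges G -> E != F ->
    curve E p -> curve F p -> exists2 z, z \in (E :&: F)%SET & p = pos z.
  move=> /edgeP[x [y [xy ->]]] /edgeP[z [w [zw ->]]] EF; rewrite !curveE => pE pF.
  have [v /andP[v1 v2] ->] := meet x y z w xy zw EF p pE pF.
  by exists v => //; rewrite !inE in v1 v2 *; rewrite v1 v2.
exists pos, curve; split => //.
- move=> x y xy; rewrite curveE; apply: seg_is_arc; apply/eqP => /ipos e.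
  by move: xy; rewrite e adj_irrefl.
(* The point of [z] lies on [E] and on an edge at [z]. If [z] is not an end of [E], these edges
   differ, so the point belongs to a common end, which is [z] by injectivity. *)
move=> E z EE cz; apply: contraT => zE; have [y zy] := deg z.
have [||||v] := cross E [set z; y]%SET (pos z) EE.
- by rewrite inE; apply/existsP; exists z; apply/existsP; exists y; rewrite zy eqxx.
- by apply: contraNneq zE => ->; rewrite !inE eqxx.
- exact: cz.
- rewrite curveE; exists 0; rewrite ?lexx ?ler01 //.
  by rewrite /seg_point subr0 !mul1r !mul0r !addr0 -surjective_pairing.
by rewrite inE => /andP[vE _] /ipos zv; move: zE; rewrite zv vE.
Qed.
End Segments.

(** * A computable check for drawings with integer coordinates *)

Definition edge_rel (es : seq (nat * nat)) : rel nat :=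
  fun x y => ((x, y) \in es) || ((y, x) \in es).

Lemma edge_rel_sym es : symmetric (edge_rel es).
Proof. by move=> x y; rewrite /edge_rel orbC. Qed.

Lemma edge_rel_irrefl es : all (fun e => e.1 != e.2) es -> irreflexive (edge_rel es).
Proof.
move=> /allP H x; rewrite /edge_rel orbb; apply/negbTE/negP => /H.
by rewrite eqxx.
Qed.

Definition same_edge (T : eqType) (x y z w : T) :=
  (x == z) && (y == w) || (x == w) && (y == z).

(** Twice the signed area of the triangle [a], [b], [c]; its sign tells on which side of the line
    through [a] and [b] the point [c] lies. *)
Definition cross (a b c : int * int) : int :=
  (b.1 - a.1) * (c.2 - a.2) - (b.2 - a.2) * (c.1 - a.1).

(** The line through [x] and [y] serves as separating line. It may touch the other edge only in [z],
    and only if [z] is an end of the first edge. The test is not symmetric, so [drawing_check] tries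
    either edge as the line and either end of the other as [z]. *)
Definition separated (pos : nat -> int * int) x y z w :=
  let fz := cross (pos x) (pos y) (pos z) in
  let fw := cross (pos x) (pos y) (pos w) in
  ((0 <= fz) && (0 < fw) || (fz <= 0) && (fw < 0)) &&
  ((fz == 0) ==> (z \in [:: x; y])).

Definition drawing_check n (E : rel nat) (pos : nat -> int * int) :=
  let es := [seq e <- [seq (x, y) | x <- iota 0 n, y <- iota 0 n] | E e.1 e.2] in
  all (fun e => all (fun e' =>
    [|| same_edge e.1 e.2 e'.1 e'.2,
        separated pos e.1 e.2 e'.1 e'.2, separated pos e.1 e.2 e'.2 e'.1,
        separated pos e'.1 e'.2 e.1 e.2 | separated pos e'.1 e'.2 e.2 e.1]) es) es.

Section Drawing.
Variable R : realType.

Definition real_point (a : int * int) : R * R := (a.1%:~R, a.2%:~R).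

Lemma meet_at_ends_swap (T : eqType) (pos : T -> R * R) x y z w :
  meet_at_ends pos x y z w -> meet_at_ends pos z w x y.
Proof. by move=> H p h1 h2; have [v h ->] := H p h2 h1; exists v; rewrite // andbC. Qed.

Lemma meet_at_ends_rev (T : eqType) (pos : T -> R * R) x y z w :
  meet_at_ends pos x y z w -> meet_at_ends pos x y w z.
Proof.
move=> H p h1 /seg_sym h2; have [v h ->] := H p h1 h2; exists v => //.
by rewrite !inE [(v == w) || _]orbC in h *.
Qed.

Lemma separated_meet pos x y z w : separated pos x y z w ->
  meet_at_ends (real_point \o pos) x y z w.
Proof.
case/andP=> sep zE p sa sc.
set a := pos x in sep zE; set b := pos y in sep zE.
(* [cross] as an affine form of its third point; the sign [s], later 1 or -1, selects the side on
   which the second edge lies. *)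
have crossE s c : let f (q : R * R) := s * (a.2 - b.2)%:~R * q.1 + s * (b.1 - a.1)%:~R * q.2 +
      s * (a.1 * b.2 - a.2 * b.1)%:~R in
    f (real_point c) = s * (cross a b c)%:~R.
  by rewrite /= /cross !(rmorphB, rmorphM) /=; ring.
have concl : p = real_point (pos z) -> cross a b (pos z) = 0 ->
    exists2 v, (v \in [:: x; y]) && (v \in [:: z; w]) & p = (real_point \o pos) v.
  by move=> -> /eqP fz; exists z => //; rewrite mem_head andbT (implyP zE).
have ca : cross a b a = 0 by rewrite /cross; ring.
have cb : cross a b b = 0 by rewrite /cross; ring.
have step (s : R) : 0 <= s * (cross a b (pos z))%:~R ->
    0 < s * (cross a b (pos w))%:~R -> cross a b (pos z) = 0 /\ p = real_point (pos z).
  move=> hz hw; have := seg_separate (u := s * (a.2 - b.2)%:~R)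
    (v := s * (b.1 - a.1)%:~R) (w := s * (a.1 * b.2 - a.2 * b.1)%:~R) _ _ _ _ sa sc.
  rewrite /= !crossE ca cb mulr0 lexx => /(_ isT isT hz hw) [-> /eqP].
  rewrite mulf_eq0 intr_eq0 => /orP[/eqP s0|/eqP //].
  by move: hw; rewrite s0 mul0r ltxx.
case/orP: sep => /andP[fz fw].
- by have [||f0 p0] := step 1; rewrite ?mul1r ?ler0z ?ltr0z //; apply: concl.
- have [||f0 p0] := step (-1); last exact: concl.
    by rewrite mulN1r oppr_ge0 lerz0.
  by rewrite mulN1r oppr_gt0 ltrz0.
Qed.

Lemma drawing_checkP n E pos : drawing_check n E pos ->
  forall x y z w, (x < n)%N -> (y < n)%N -> (z < n)%N -> (w < n)%N ->
  E x y -> E z w -> ~~ same_edge x y z w ->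
  meet_at_ends (real_point \o pos) x y z w.
Proof.
move=> /allP H x y z w xn yn zn wn xy zw /negbTE ns.
have mem a b : (a < n)%N -> (b < n)%N -> E a b ->
    (a, b) \in [seq e <- [seq (x, y) | x <- iota 0 n, y <- iota 0 n] | E e.1 e.2].
  move=> an bn ab; rewrite mem_filter ab /=; apply/allpairsP.
  by exists (a, b); rewrite !mem_iota.
have /allP/(_ _ (mem z w zn wn zw)) := H _ (mem x y xn yn xy).
rewrite /= ns /= => /or4P[] /separated_meet //.
- by move/meet_at_ends_rev.
- by move/meet_at_ends_swap.
- by move/meet_at_ends_rev/meet_at_ends_swap.
Qed.

(** * The triangle containing the right part *)

Definition in_triangle (z : R * R) := [/\ 0 <= z.1, 0 <= z.2 & z.1 + z.2 <= 8].

Definition corner (c : R * R) := c \in [:: (0, 0); (8, 0); (0, 8)].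

(** Corners are extreme points: for each one there is an affine form that is nonnegative on the
    triangle and vanishes only at that corner. *)
Lemma seg_corner a b c : in_triangle a -> in_triangle b -> corner c ->
  seg a b c -> a = c \/ b = c.
Proof.
case: a b => [ax ay] [bx b_y] [/= a1 a2 a3] [/= b1 b2 b3].
rewrite /corner !inE => /or3P[] /eqP ->.
- apply: (seg_extreme (u := 1) (v := 1) (w := 0)) => /=; [lra|lra|lra|].
  by move=> ?; congr pair; lra.
- apply: (seg_extreme (u := -1) (v := 0) (w := 8)) => /=; [lra|lra|lra|].
  by move=> ?; congr pair; lra.
- apply: (seg_extreme (u := 0) (v := -1) (w := 8)) => /=; [lra|lra|lra|].
  by move=> ?; congr pair; lra.
Qed.

(* Maps the triangle (0,0), (8,0), (0,8) onto (0,0), (0,8), (8/3,8/3), which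
   makes room for the next vertex at (8,0). *)
Definition squeeze (z : R * R) : R * R := (z.2 / 3, z.1 + z.2 / 3).

Lemma squeeze_inj : injective squeeze.
Proof.
move=> [a1 a2] [b1 b2] [] e1 e2; congr pair; last lra.
by move: e2; lra.
Qed.

Lemma seg_squeeze a b p : seg (squeeze a) (squeeze b) p ->
  exists2 q, seg a b q & p = squeeze q.
Proof.
case=> t t01 ->; exists (seg_point a b t); first by exists t.
by rewrite /squeeze /seg_point /=; congr pair; lra.
Qed.
End Drawing.

(** * Extending the drawing of the right part by one vertex *)

Section StripDrawing.
Variables (R : realType) (q N : nat) (R0 : rel nat).
Hypotheses (qN : (q + 3 <= N)%N) (R0sym : symmetric R0) (R0irr : irreflexive R0).

(** The corners carry the vertices with links to the rest of the graph: [q], which will be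
    [(2 * k).+1], and the current u and v. *)
Record strip_drawing n (pos : nat -> R * R) : Prop := StripDrawing {
  strip_triangle : forall x, (q <= x < n)%N -> in_triangle (pos x);
  strip_posq : pos q = (0, 0);
  strip_posu : pos n.-1 = (8, 0);
  strip_posv : pos n.-2 = (0, 8);
  strip_inj : {in [pred x | q <= x < n]%N &, injective pos};
  strip_meet : forall x y z w,
    (q <= x < n)%N -> (q <= y < n)%N -> (q <= z < n)%N -> (q <= w < n)%N ->
    strip_adj N R0 x y -> strip_adj N R0 z w -> ~~ same_edge x y z w ->
    meet_at_ends pos x y z w }.

Definition next_pos n (pos : nat -> R * R) x :=
  if x == n then (8, 0) else squeeze (pos x).

Lemma strip_adj_new n x : (N <= n)%N -> (x < n)%N ->
  strip_adj N R0 n x -> x = n.-1 \/ x = n.-2.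
Proof. by move=> ln xn; rewrite /strip_adj ltnNge ln /=; lia. Qed.

Lemma strip_adj_irrefl x : strip_adj N R0 x x = false.
Proof. by rewrite /strip_adj R0irr eqxx; case: ifP. Qed.

Section Step.
Variables (n : nat) (pos : nat -> R * R).
Hypotheses (ln : (N <= n)%N) (sd : strip_drawing n pos).

Lemma next_posE x : (x < n)%N -> next_pos n pos x = squeeze (pos x).
Proof. by rewrite /next_pos => xn; case: eqP => // ?; lia. Qed.

Lemma next_posn : next_pos n pos n = (8, 0).
Proof. by rewrite /next_pos eqxx. Qed.

Lemma squeeze_triangle (z : R * R) : in_triangle z -> in_triangle (squeeze z).
Proof. by case=> ? ? ?; split; rewrite /squeeze /=; lra. Qed.

Lemma next_pos_inj :
  {in [pred x | q <= x < n.+1]%N &, injective (next_pos n pos)}.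
Proof.
have new x : (q <= x < n)%N -> next_pos n pos x != (8, 0).
  move=> xn; apply/eqP => e; case: (strip_triangle sd xn) => t1 t2 t3.
  by move: e; rewrite next_posE; [case=> /= ? ?; lra | lia].
move=> x y; rewrite !inE !ltnS => /andP[qx xn] /andP[qy yn].
have [->|xn'] := eqVneq x n; have [->|yn'] := eqVneq y n => //.
- by rewrite next_posn => /esym/eqP; rewrite (negbTE (new y _)) //; lia.
- by rewrite next_posn => /eqP; rewrite (negbTE (new x _)) //; lia.
rewrite !next_posE; [|lia|lia].
by move=> /squeeze_inj/(strip_inj sd); apply; rewrite inE; lia.
Qed.

Lemma next_meet_old x y z w :
  (q <= x < n)%N -> (q <= y < n)%N -> (q <= z < n)%N -> (q <= w < n)%N ->
  strip_adj N R0 x y -> strip_adj N R0 z w -> ~~ same_edge x y z w ->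
  meet_at_ends (next_pos n pos) x y z w.
Proof.
move=> xn yn zn wn xy zw ns p.
have [/andP[_ x'] /andP[_ y'] /andP[_ z'] /andP[_ w']] := And4 xn yn zn wn.
rewrite !next_posE // => /seg_squeeze[r r1 ->] /seg_squeeze[s s1 /squeeze_inj e].
rewrite -e in s1; have [v vE ->] := strip_meet sd xn yn zn wn xy zw ns r1 s1.
exists v => //; rewrite next_posE //.
by case/andP: vE; rewrite !inE => /orP[] /eqP ->.
Qed.

(** The new edge is the side of the triangle from [(8, 0)] to [(0, 8)], on the line where the
    coordinates sum to 8. The squeezed triangle touches that line only at the image of [n.-1]. *)
Lemma next_meet_u x y : (q <= x < n)%N -> (q <= y < n)%N -> strip_adj N R0 x y ->
  meet_at_ends (next_pos n pos) n n.-1 x y.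
Proof.
have main z w : (q <= z < n)%N -> (q <= w < n)%N -> w != n.-1 ->
    meet_at_ends (next_pos n pos) n n.-1 z w.
  move=> zn wn wu p; have [[t1 t2 t3] [s1 s2 s3]] := (strip_triangle sd zn, strip_triangle sd wn).
  rewrite next_posn !next_posE; try lia.
  rewrite (strip_posu sd) => h1 h2.
  have wne : pos w != (8, 0).
    apply: contra_neqN wu => /eqP e; apply: (strip_inj sd); rewrite ?inE ?(strip_posu sd) //; lia.
  have [||||-> /= f0] := seg_separate (u := -1) (v := -1) (w := 8) _ _ _ _ h1 h2;
    rewrite /squeeze /=; try lra.
    case: ltP => // h.
    case/eqP: wne; rewrite [pos w]surjective_pairing; congr pair; lra.
  have zu : z = n.-1.
    apply: (strip_inj sd); rewrite ?inE; try lia.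
    by rewrite (strip_posu sd) [pos z]surjective_pairing; congr pair; lra.
  by exists z; rewrite ?next_posE ?zu ?inE ?eqxx ?orbT //; lia.
(* Without loops at most one end is [n.-1]; the edge is reversed if it is the second one. *)
move=> xn yn xy; have [yu|yu] := eqVneq y n.-1; last exact: main.
apply: meet_at_ends_rev; apply: main => //; apply: contraTneq xy => ->.
by rewrite yu strip_adj_irrefl.
Qed.

(** The new edge ends at the image [(8/3, 8/3)] of the corner [(0, 8)]. The line [2 x + y = 8]
    through it carries a side of the squeezed triangle and has [(8, 0)] strictly on its far side, so
    only this image can be a common point. Being the image of a corner, it lies on an old edge only
    as an end. *)
Lemma next_meet_v x y : (q <= x < n)%N -> (q <= y < n)%N -> strip_adj N R0 x y ->
  meet_at_ends (next_pos n pos) n n.-2 x y.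
Proof.
move=> xn yn xy p; have [tx ty] := (strip_triangle sd xn, strip_triangle sd yn).
have [[t1 t2 t3] [s1 s2 s3]] := (tx, ty).
rewrite next_posn !next_posE; try lia.
rewrite (strip_posv sd) => /seg_sym h1 h2.
have [||||e _] := seg_separate (u := 2) (v := 1) (w := - 8) _ _ _ _ h2 h1;
  [rewrite /squeeze /=; lra..|].
have [r hr] := seg_squeeze h2; rewrite e => /squeeze_inj rE; rewrite -{r}rE in hr.
have cv : corner ((0, 8) : R * R) by rewrite /corner !inE eqxx !orbT.
have vn : (q <= n.-2 < n)%N by lia.
have ends z : (q <= z < n)%N -> pos z = (0, 8) -> z = n.-2.
  by move=> zn ez; apply: (strip_inj sd); rewrite ?inE ?(strip_posv sd).
have [/(ends _ xn) xv|/(ends _ yn) yv] := seg_corner tx ty cv hr.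
  by exists x; rewrite ?inE ?eqxx ?xv ?orbT ?eqxx ?orbT // next_posE ?(strip_posv sd) //; lia.
by exists y; rewrite ?inE ?eqxx ?yv ?orbT ?eqxx ?orbT // next_posE ?(strip_posv sd) //; lia.
Qed.

Lemma next_meet_new : meet_at_ends (next_pos n pos) n n.-1 n n.-2.
Proof.
move=> p; rewrite next_posn !next_posE; try lia.
rewrite (strip_posu sd) (strip_posv sd) => h1 h2.
have [||||-> _] := seg_separate (u := -1) (v := -1) (w := 8) _ _ _ _ h1 h2;
  [rewrite /squeeze /=; lra..|].
by exists n; rewrite ?inE ?eqxx // next_posn.
Qed.

Lemma strip_drawing_next : strip_drawing n.+1 (next_pos n pos).
Proof.
split.
- move=> x /andP[qx]; rewrite ltnS leq_eqVlt => /orP[/eqP->|xn].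
    by rewrite next_posn; split => /=; lra.
  rewrite next_posE //; apply: squeeze_triangle; apply: (strip_triangle sd).
  by rewrite qx.
- rewrite next_posE ?(strip_posq sd) /squeeze /=; last lia.
  by congr pair; lra.
- exact: next_posn.
- rewrite /= next_posE ?(strip_posu sd) /squeeze /=; last lia.
  by congr pair; lra.
- exact: next_pos_inj.
(* With ends and edges put in decreasing order, the new vertex can occur only as [a], and as [c]
   when both edges are new. *)
have main a b c d : (q <= a < n.+1)%N -> (q <= b < n.+1)%N -> (q <= c < n.+1)%N ->
    (q <= d < n.+1)%N -> strip_adj N R0 a b -> strip_adj N R0 c d ->
    ~~ same_edge a b c d -> (b <= a)%N -> (d <= c)%N -> (c <= a)%N ->
    meet_at_ends (next_pos n pos) a b c d.
  move=> an bn cn dn ab cd ns ba dc ca.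
  have [an'|na] := ltnP a n; first by apply: next_meet_old => //; lia.
  have {an na} aE : a = n by lia.
  subst a; have bn' : (b < n)%N.
    by rewrite ltn_neqAle ba andbT; apply: contraTneq ab => ->; rewrite strip_adj_irrefl.
  have dn' : (d < c)%N.
    by rewrite ltn_neqAle dc andbT; apply: contraTneq cd => ->; rewrite strip_adj_irrefl.
  have [cn'|nc] := ltnP c n.
    by have [->|->] := strip_adj_new ln bn' ab;
      [apply: next_meet_u | apply: next_meet_v]; rewrite //; lia.
  have {cn nc} cE : c = n by lia.
  subst c; move: ns.
  have [->|->] := strip_adj_new ln bn' ab; have [->|->] := strip_adj_new ln dn' cd;
    rewrite /same_edge ?eqxx // => _; first exact: next_meet_new.
  by apply: meet_at_ends_swap; exact: next_meet_new.
have sameC a b c d : same_edge a b c d = same_edge c d a b.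
  by rewrite /same_edge ![_ == c]eq_sym ![_ == d]eq_sym [(d == a) && _]andbC.
have same_rev a b c d : same_edge a b c d = same_edge a b d c.
  by rewrite /same_edge orbC.
have adjC := strip_adj_sym N R0sym.
move=> x y z w.
wlog yx : x y / (y <= x)%N => [H|].
  have [yx|/ltnW xy] := leqP y x; first exact: H.
  move=> xn yn zn wn exy ezw ns.
  apply/meet_at_ends_swap/meet_at_ends_rev/meet_at_ends_swap; apply: H => //.
    by rewrite adjC.
  by rewrite sameC same_rev -sameC.
wlog wz : z w / (w <= z)%N => [H|].
  have [wz|/ltnW zw] := leqP w z; first exact: H.
  move=> xn yn zn wn exy ezw ns.
  by apply: meet_at_ends_rev; apply: H; rewrite // 1?adjC // -same_rev.
move=> xn yn zn wn exy ezw ns.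
have [zx|/ltnW xz] := leqP z x; first exact: main.
by apply: meet_at_ends_swap; apply: main => //; rewrite sameC.
Qed.
End Step.
End StripDrawing.

(** * The two families *)

(* K5 minus the edge {0, 4}. *)
Definition K5_block : rel nat := edge_rel
  [:: (0, 1); (0, 2); (0, 3); (1, 2); (1, 3); (1, 4); (2, 3); (2, 4); (3, 4)]%N.

(** Before the shift, 0 is the vertex joined to p, 7 is u and 6 is v; they have degrees 3, 2 and 3,
    which leaves room for the links. *)
Definition right8 : rel nat := edge_rel [seq (11 + e.1, 11 + e.2)%N | e <-
  [:: (0, 1); (0, 4); (0, 5); (1, 3); (1, 4); (1, 5); (2, 3); (2, 4); (2, 6);
      (2, 7); (3, 5); (3, 6); (4, 5); (6, 7)]%N].

(* The octahedron minus the edge {0, 5}. *)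
Definition octahedron_block : rel nat := edge_rel
  [:: (0, 2); (0, 3); (0, 4); (1, 2); (1, 3); (1, 4); (1, 5); (2, 4); (2, 5);
      (3, 4); (3, 5)]%N.

(** Before the shift, 0 is the vertex joined to p, 8 is u and 7 is v. *)
Definition right9 : rel nat := edge_rel [seq (13 + e.1, 13 + e.2)%N | e <-
  [:: (0, 1); (0, 2); (0, 4); (1, 2); (1, 3); (1, 5); (2, 3); (2, 4); (3, 4);
      (3, 5); (4, 6); (5, 6); (5, 7); (6, 7); (6, 8); (7, 8)]%N].

(** A straight-line drawing of the graph on 22 vertices: the two blocks, then p at [(17, -7)], then
    the right part, with its vertices 13, 20 and 21 at the corners of the triangle. The line where
    the coordinates sum to 8 separates the right part from everything else. *)
Definition coords : nat -> int * int := nth (0, 0)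
  [:: (18, 5); (13, 6); (15, 8); (14, 3); (15, 5); (11, 6); (19, 13); (8, 14);
      (11, 17); (13, 10); (15, 12); (4, 14); (17, -7); (0, 0); (0, 2); (1, 2);
      (2, 3); (1, 1); (1, 5); (4, 2); (0, 8); (8, 0)].

Local Notation planar_adj := (gadget_adj 6 22 octahedron_block right9).

Lemma coords_drawing_check : drawing_check 22 (planar_adj 22) coords.
Proof. by vm_compute. Qed.

Lemma coords_uniq : uniq (map coords (iota 0 22)).
Proof. by vm_compute. Qed.

Lemma coords_left : all (fun x => 8 < (coords x).1 + (coords x).2) (iota 0 13).
Proof. by vm_compute. Qed.

Lemma coords_right : all (fun x =>
  [&& 0 <= (coords x).1, 0 <= (coords x).2 & (coords x).1 + (coords x).2 <= 8])
  (iota 13 9).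
Proof. by vm_compute. Qed.

(* Where [x] lies in the drawing for n = 22, for [x] not in the interior of the
   right part. *)
Definition frame_label n x : nat :=
  if (x <= 13)%N then x else if x == n.-1 then 21 else 20.

Definition on_frame n x := [|| x <= 13, x == n.-1 | x == n.-2]%N.

Lemma frame_label_inj n : (22 <= n)%N -> {in on_frame n &, injective (frame_label n)}.
Proof.
move=> ln x y; rewrite !unfold_in /on_frame /frame_label => xf yf.
by do !case: ifP; lia.
Qed.

Lemma frame_label_lt n x : (frame_label n x < 22)%N.
Proof. by rewrite /frame_label; do !case: ifP; lia. Qed.

(** Edges with an end outside the right part are, after relabelling, edges of the graph on 22
    vertices. Among these vertices only p, which is 12, is joined to the corner 13. *)
Lemma frame_edge n x y : (22 <= n)%N -> (x < 13)%N -> planar_adj n x y ->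
  [/\ on_frame n y, planar_adj 22 (frame_label n x) (frame_label n y) &
      y = 13%N -> x = 12%N].
Proof.
move=> ln xl; rewrite {1}/frame_label (ltnW xl).
have u1 : (n.-1 <= 13)%N = false by lia.
have v1 : (n.-2 <= 13)%N = false by lia.
have uv : (n.-2 == n.-1) = false by lia.
rewrite {1}/gadget_adj => /or4P[/and3P[x6 y6 h]|/and3P[x12 y12 h]|/and3P[]|]; try lia.
- have yl : (y <= 13)%N by lia.
  by rewrite /on_frame /frame_label yl /gadget_adj x6 y6 h; split => //; lia.
- have yl : (y <= 13)%N by lia.
  by rewrite /on_frame /frame_label yl /gadget_adj x12 y12 h orbT; split => //; lia.
rewrite /link /on_frame /frame_label.
case/orP; repeat first [case/orP | case/andP => /eqP ? /eqP ?]; subst; try lia;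
  rewrite ?u1 ?v1 ?uv ?eqxx ?orbT; split => //; lia.
Qed.

(** * Drawings of the planar family *)

Section OctahedralDrawing.
Variable R : realType.

Fixpoint strip_pos m : nat -> R * R :=
  if m is m'.+1 then next_pos (22 + m') (strip_pos m') else @real_point R \o coords.

Definition gadget_pos n x : R * R :=
  if (x < 13)%N then real_point R (coords x) else strip_pos (n - 22) x.

Lemma real_point_inj : injective (@real_point R).
Proof. by move=> [a1 a2] [b1 b2] [] /intr_inj-> /intr_inj->. Qed.

Lemma coords_inj : {in [pred x | x < 22]%N &, injective coords}.
Proof.
move=> x y; rewrite !inE => xl yl e; apply/eqP.
rewrite -(nth_uniq (0, 0) _ _ coords_uniq) ?size_map ?size_iota //.
by rewrite !(nth_map 0%N) ?size_iota // !nth_iota // e.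
Qed.

Lemma planar_meet22 x y z w :
  (x < 22)%N -> (y < 22)%N -> (z < 22)%N -> (w < 22)%N ->
  planar_adj 22 x y -> planar_adj 22 z w -> ~~ same_edge x y z w ->
  meet_at_ends (@real_point R \o coords) x y z w.
Proof. exact: drawing_checkP coords_drawing_check _ _ _ _. Qed.

Lemma right9_sym : symmetric right9. Proof. exact: edge_rel_sym. Qed.

Lemma right9_irrefl : irreflexive right9. Proof. exact: edge_rel_irrefl. Qed.

Lemma planar_adj_strip n x y : (22 <= n)%N -> (13 <= x)%N -> (13 <= y)%N ->
  planar_adj n x y = strip_adj 22 right9 x y.
Proof. by move=> ln xl yl; apply: gadget_adj_R. Qed.

Lemma strip_pos_drawing m : strip_drawing 13 22 right9 (22 + m) (strip_pos m).
Proof.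
elim: m => [|m IHm]; last first.
  by rewrite addnS; apply: strip_drawing_next; rewrite ?leq_addr //;
    [exact: right9_sym | exact: right9_irrefl].
rewrite addn0; split => //.
- move=> x xl; have /allP/(_ x) := coords_right; rewrite mem_iota.
  move=> /(_ xl)/and3P[h1 h2 h3]; split; rewrite /= ?ler0z //.
  by rewrite -intrD (ler_int _ _ 8).
- move=> x y; rewrite !inE => /andP[_ xl] /andP[_ yl] /real_point_inj.
  exact: coords_inj.
move=> x y z w /andP[x1 x2] /andP[y1 y2] /andP[z1 z2] /andP[w1 w2] xy zw ns.
by apply: planar_meet22; rewrite ?planar_adj_strip.
Qed.

Section Meeting.
Variable n : nat.
Hypothesis ln : (22 <= n)%N.

Let sd : strip_drawing 13 22 right9 n (strip_pos (n - 22)).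
Proof. by have := strip_pos_drawing (n - 22); rewrite subnKC. Qed.

Lemma gadget_pos_left x : (x < 13)%N -> 8 < (gadget_pos n x).1 + (gadget_pos n x).2.
Proof.
move=> xl; rewrite /gadget_pos xl /= -intrD (ltr_int _ 8).
by apply: (allP coords_left); rewrite mem_iota.
Qed.

Lemma gadget_posR x : (13 <= x)%N -> gadget_pos n x = strip_pos (n - 22) x.
Proof. by move=> xl; rewrite /gadget_pos ltnNge xl. Qed.

Lemma gadget_pos_frame x : on_frame n x ->
  gadget_pos n x = real_point R (coords (frame_label n x)).
Proof.
have [xl|xl] := ltnP x 13; first by rewrite /gadget_pos /frame_label xl (ltnW xl).
rewrite gadget_posR // => /or3P[x13|/eqP->|/eqP->].
- have -> : x = 13%N by lia.
  by rewrite (strip_posq sd).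
- rewrite (strip_posu sd) /frame_label eqxx (_ : (_ <= 13)%N = false) //; lia.
- rewrite (strip_posv sd) /frame_label (_ : (_ <= 13)%N = false); last lia.
  by rewrite ifF //; lia.
Qed.

Lemma gadget_pos_inj : {in [pred x | x < n]%N &, injective (gadget_pos n)}.
Proof.
have LR x y : (x < 13)%N -> (13 <= y < n)%N -> gadget_pos n x <> gadget_pos n y.
  move=> xl yl e; have := gadget_pos_left xl; rewrite {}e gadget_posR; last lia.
  by case: (strip_triangle sd yl) => *; lra.
move=> x y; rewrite !inE => xn yn.
have [xl|xl] := ltnP x 13; have [yl|yl] := ltnP y 13.
- rewrite /gadget_pos xl yl => /real_point_inj/coords_inj; apply; rewrite inE; lia.
- by move/LR => /(_ xl); rewrite yl yn => /(_ isT).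
- by move/esym/LR => /(_ yl); rewrite xl xn => /(_ isT).
- by rewrite !gadget_posR // => /(strip_inj sd); apply; rewrite inE; lia.
Qed.

(** An edge with an end outside the right part meets the triangle at most in a corner that is its
    other end, and an edge of the right part contains a corner only as an end. *)
Lemma meet_left_right x y z w : (x < 13)%N -> (y < n)%N -> planar_adj n x y ->
  (13 <= z < n)%N -> (13 <= w < n)%N -> meet_at_ends (gadget_pos n) x y z w.
Proof.
move=> xl yn xy zn wn p h1 h2.
have [yf _ y13] := frame_edge ln xl xy.
have [tz tw] := (strip_triangle sd zn, strip_triangle sd wn).
rewrite !gadget_posR in h2; try lia.
have fx := gadget_pos_left xl.
have [[z1 z2 z3] [w1 w2 w3]] := (tz, tw).
have [yl|yl] := ltnP y 13.
  have fy := gadget_pos_left yl.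
  have [||||_ f0] := seg_separate (u := 1) (v := 1) (w := - 8) _ _ _ _ h2 h1; [lra..|].
  have : (0 : R) < 0 by lra.
  by rewrite ltxx.
have py : p = gadget_pos n y /\ corner (gadget_pos n y).
  case/or3P: yf => yE.
  - have y13' : y = 13%N by lia.
    have py : gadget_pos n y = (0, 0) by rewrite y13' gadget_posR // (strip_posq sd).
    (* The corner [(0, 0)] is off the line used for the other two corners. Its only outside
       neighbour p lies below the horizontal axis, which separates instead. *)
    have px : (gadget_pos n x).2 = -7 by rewrite (y13 y13') /gadget_pos /= mulrNz.
    rewrite {2}py /corner inE eqxx; split=> //; move/seg_sym: h1 => h1.
    by have [||||-> //] := seg_separate (u := 0) (v := -1) (w := 0) _ _ _ _ h2 h1;
      rewrite ?py ?px /=; clear py; lra.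
  - have py : gadget_pos n y = (8, 0) by rewrite gadget_posR // (eqP yE) (strip_posu sd).
    rewrite {2}py /corner !inE eqxx orbT; split=> //; move/seg_sym: h1 => h1.
    by have [||||-> //] := seg_separate (u := 1) (v := 1) (w := -8) _ _ _ _ h2 h1;
      rewrite ?py /=; clear py; lra.
  - have py : gadget_pos n y = (0, 8) by rewrite gadget_posR // (eqP yE) (strip_posv sd).
    rewrite {2}py /corner !inE eqxx !orbT; split=> //; move/seg_sym: h1 => h1.
    by have [||||-> //] := seg_separate (u := 1) (v := 1) (w := -8) _ _ _ _ h2 h1;
      rewrite ?py /=; clear py; lra.
case: py => py cy; rewrite py in h2.
have ends v : (13 <= v < n)%N -> strip_pos (n - 22) v = gadget_pos n y -> v = y.
  by move=> vn; rewrite gadget_posR // => /(strip_inj sd); apply; rewrite inE ?yl.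
exists y => //; rewrite !inE eqxx orbT /=.
by have [/(ends _ zn)->|/(ends _ wn)->] := seg_corner tz tw cy h2; rewrite eqxx ?orbT.
Qed.

(** All four ends lie on the frame, whose positions do not change with [n], so the checked drawing
    for 22 vertices decides. *)
Lemma meet_left_left x y z w : (x < 13)%N -> (z < 13)%N ->
  planar_adj n x y -> planar_adj n z w -> ~~ same_edge x y z w ->
  meet_at_ends (gadget_pos n) x y z w.
Proof.
move=> xl zl xy zw ns p.
have [yf xy' _] := frame_edge ln xl xy; have [wf zw' _] := frame_edge ln zl zw.
have left_frame a : (a < 13)%N -> on_frame n a by rewrite /on_frame => /ltnW ->.
have [xf zf] := (left_frame x xl, left_frame z zl).
have fE a b : on_frame n a -> on_frame n b ->
    (frame_label n a == frame_label n b) = (a == b).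
  by move=> af bf; apply/eqP/eqP => [/(frame_label_inj ln)-> //|->].
have ns' : ~~ same_edge (frame_label n x) (frame_label n y) (frame_label n z) (frame_label n w).
  by rewrite /same_edge !fE.
rewrite !gadget_pos_frame // => h1 h2.
have [|||| v /andP[v1 v2] ->] := planar_meet22 _ _ _ _ xy' zw' ns' h1 h2;
  [exact: frame_label_lt..|].
have [a aE va] : exists2 a, a \in [:: x; y] & v = frame_label n a.
  by move: v1; rewrite !inE => /orP[] /eqP ->; [exists x|exists y]; rewrite ?inE ?eqxx ?orbT.
have af : on_frame n a by move: aE; rewrite !inE => /orP[] /eqP ->.
exists a; last by rewrite gadget_pos_frame // va.
by rewrite aE; move: v2; rewrite va !inE !fE.
Qed.

Lemma gadget_meet x y z w :
  (x < n)%N -> (y < n)%N -> (z < n)%N -> (w < n)%N ->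
  planar_adj n x y -> planar_adj n z w -> ~~ same_edge x y z w ->
  meet_at_ends (gadget_pos n) x y z w.
Proof.
have adjC : symmetric (planar_adj n).
  by apply: gadget_adj_sym; exact: edge_rel_sym.
have sameC (a b c d : nat) : same_edge a b c d = same_edge b a c d.
  by rewrite /same_edge orbC [(b == c) && _]andbC [(b == d) && _]andbC.
have same_rev (a b c d : nat) : same_edge a b c d = same_edge a b d c.
  by rewrite /same_edge orbC.
(* With the smaller end first, an edge lies in the right part exactly when its first end is at least
   13. *)
wlog yx : x y / (x <= y)%N => [H|].
  have [yx|/ltnW xy] := leqP x y; first exact: H.
  move=> xn yn zn wn exy ezw ns.
  apply/meet_at_ends_swap/meet_at_ends_rev/meet_at_ends_swap; apply: H => //.
    by rewrite adjC.
  by rewrite sameC.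
wlog wz : z w / (z <= w)%N => [H|].
  have [wz|/ltnW zw] := leqP z w; first exact: H.
  move=> xn yn zn wn exy ezw ns.
  by apply: meet_at_ends_rev; apply: H; rewrite // 1?adjC // -same_rev.
move=> xn yn zn wn exy ezw ns.
have [xl|xl] := ltnP x 13; have [zl|zl] := ltnP z 13.
- exact: meet_left_left.
- by apply: meet_left_right => //; lia.
- by apply: meet_at_ends_swap; apply: meet_left_right => //; lia.
have [yl wl] : (13 <= y /\ 13 <= w)%N by lia.
move=> p; rewrite !gadget_posR // => h1 h2.
have [||||||v vE ->] := strip_meet sd _ _ _ _ _ _ ns h1 h2.
1-4: by apply/andP.
1-2: by rewrite -(planar_adj_strip ln).
exists v => //; rewrite gadget_posR //.
by case/andP: vE; rewrite !inE => /orP[] /eqP ->.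
Qed.
End Meeting.
End OctahedralDrawing.

Lemma block_degreeP k B : all (fun x =>
    count (B x) (iota 0 k) + (x == 0) + (x == k.-1) == 4)%N (iota 0 k) ->
  forall x, (x < k)%N -> (count (B x) (iota 0 k) + (x == 0) + (x == k.-1) = 4)%N.
Proof. by move=> /allP H x xk; apply/eqP/H; rewrite mem_iota. Qed.

Lemma right_degreeP q N R0 : (q < N)%N -> all (fun x =>
    count (R0 x) (iota q.+1 (N - q.+1)) + (x == q.+1) + (x == N.-1).*2 +
      (x == N.-2) == 4)%N (iota q.+1 (N - q.+1)) ->
  forall x, (q < x < N)%N -> (count (R0 x) (iota q.+1 (N - q.+1)) +
    (x == q.+1) + (x == N.-1).*2 + (x == N.-2) = 4)%N.
Proof. by move=> qN /allP H x xl; apply/eqP/H; rewrite mem_iota subnKC. Qed.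

Lemma K5_block_irrefl : irreflexive K5_block. Proof. exact: edge_rel_irrefl. Qed.

Lemma right8_irrefl : irreflexive right8. Proof. exact: edge_rel_irrefl. Qed.

Lemma octahedron_block_irrefl : irreflexive octahedron_block.
Proof. exact: edge_rel_irrefl. Qed.

Definition K5_graph n (ln : (19 <= n)%N) : graph :=
  @gadget_graph 5 19 K5_block right8 isT isT (edge_rel_sym _) (edge_rel_sym _)
    K5_block_irrefl right8_irrefl n ln.

Definition octahedral_graph n (ln : (22 <= n)%N) : graph :=
  @gadget_graph 6 22 octahedron_block right9 isT isT (edge_rel_sym _) (edge_rel_sym _)
    octahedron_block_irrefl right9_irrefl n ln.

(** In the blocks every order of the three inner vertices gives a hamiltonian path, whence 6 = 3!.
    The count for the right part is by enumeration. *)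
Lemma K5_path_counts : [/\ size (X_paths 5 K5_block) = 6,
  size (Y_paths 5 K5_block) = 6 & size (R_paths 5 19 right8 0) = 4]%N.
Proof. by vm_compute. Qed.

Lemma octahedral_path_counts : [/\ size (X_paths 6 octahedron_block) = 8,
  size (Y_paths 6 octahedron_block) = 8 & size (R_paths 6 22 right9 0) = 5]%N.
Proof. by vm_compute. Qed.

Lemma K5_graph_regular n (ln : (19 <= n)%N) : regular_graph 4 (K5_graph ln).
Proof.
apply: gadget_graph_regular; [apply: block_degreeP | apply: right_degreeP => //];
  by vm_compute.
Qed.

Lemma octahedral_graph_regular n (ln : (22 <= n)%N) :
  regular_graph 4 (octahedral_graph ln).
Proof.
apply: gadget_graph_regular; [apply: block_degreeP | apply: right_degreeP => //];
  by vm_compute.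
Qed.

Lemma octahedral_graph_planar (R : realType) n (ln : (22 <= n)%N) :
  planar R (octahedral_graph ln).
Proof.
apply: (@straight_line_planar R _ (fun x : octahedral_graph ln => gadget_pos R n (val x))).
- by move=> x y /(gadget_pos_inj ln) e; apply/val_inj/e; rewrite inE ltn_ord.
- move=> x; have /eqP := @octahedral_graph_regular n ln x; rewrite eqn_leq => /andP[_].
  by move=> /(leq_trans (isT : (0 < 4)%N))/card_gt0P[y]; rewrite inE; exists y.
move=> x y z w xy zw ns p h1 h2.
have ns' : ~~ same_edge (val x) (val y) (val z) (val w).
  apply: contra ns => /orP[] /andP[/eqP/val_inj-> /eqP/val_inj->] //.
  by rewrite finset.setUC.
have [v vE ->] := gadget_meet ln (ltn_ord x) (ltn_ord y) (ltn_ord z) (ltn_ord w)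
  xy zw ns' h1 h2.
have [a aE va] : exists2 a : octahedral_graph ln, a \in [:: x; y] & v = val a.
  by case/andP: vE; rewrite !inE => /orP[] /eqP -> _; [exists x|exists y];
    rewrite ?inE ?eqxx ?orbT.
exists a; last by rewrite va.
by rewrite aE; case/andP: vE => _; rewrite va !inE !val_eqE.
Qed.

Theorem theorem1 (R : realType) :
  (forall n : nat, (19 <= n)%N ->
     exists G : graph,
       [/\ #|G| = n, connected_graph G, regular_graph 4 G
         & #|hamiltonian_cycles G| = 144%N]) /\
  (forall n' : nat, (22 <= n')%N ->
     exists G : graph,
       [/\ #|G| = n', connected_graph G, planar R G, regular_graph 4 G
         & #|hamiltonian_cycles G| = 320%N]).
Proof.
split=> n ln.
  have [X6 Y6 R4] := K5_path_counts.
  exists (K5_graph ln); split; first exact: card_ord.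
  - by apply: gadget_graph_connected; rewrite X6 Y6 R4.
  - exact: K5_graph_regular.
  - by rewrite card_gadget_cycles X6 Y6 R4.
have [X8 Y8 R5] := octahedral_path_counts.
exists (octahedral_graph ln); split; first exact: card_ord.
- by apply: gadget_graph_connected; rewrite X8 Y8 R5.
- exact: octahedral_graph_planar.
- exact: octahedral_graph_regular.
- by rewrite card_gadget_cycles X8 Y8 R5.
Qed.
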